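(* The satisfiability problem for $\mathcal{FL}^23\mathrm{T}$, the two-variable fluted fragment with three transitive relations, is undecidable.
   Context: Signatures are purely relational and formulas contain no equality. Fix variables $x_1, x_2, \ldots$. The sets $\mathcal{FL}^{[m]}$ ($m \geq 0$) are defined inductively: (i) every atom whose argument list is exactly $x_\ell, \ldots, x_m$ (in this order, a contiguous subsequence of $x_1,x_2,\ldots$; possibly empty for 0-ary predicates) is in $\mathcal{FL}^{[m]}$; (ii) $\mathcal{FL}^{[m]}$ is closed under Boolean combinations; (iii) if $\psi \in \mathcal{FL}^{[m+1]}$ then $\exists x_{m+1}\psi$ and $\forall x_{m+1}\psi$ are in $\mathcal{FL}^{[m]}$. The fluted fragment $\mathcal{FL}$ is $\bigcup_m \mathcal{FL}^{[m]}$, and $\mathcal{FL}^2$ is the set of fluted formulas using at most two variables. $\mathcal{FL}^23\mathrm{T}$ is $\mathcal{FL}^2$ over a signature containing three distinguished binary predicates that are required to be interpreted as transitive relations (other predicates are unrestricted). *)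

(* Defs.v *)
From mathcomp Require Import all_boot.
From mathcomp Require Import zify.
From Stdlib Require Import Relations.Relation_Definitions.

Set Implicit Arguments.
Unset Strict Implicit.
Unset Printing Implicit Defensive.

(** Syntax of the partial recursive functions; the index is the arity. *)
Inductive recfun : nat -> Type :=
| RZero k : recfun k
| RSucc : recfun 1
| RProj k (i : 'I_k) : recfun k
| RComp k m (g : recfun m) (h : 'I_m -> recfun k) : recfun k
| RPrim k (f : recfun k) (g : recfun k.+2) : recfun k.+1
| RMu k (f : recfun k.+1) : recfun k.

(** [eval f v y]: the partial function denoted by [f] is defined at [v], with
    value [y].  In the [RPrim] case, [t i] is the value of the function at
    [i :: behead v]. *)
Fixpoint eval k (f : recfun k) : k.-tuple nat -> nat -> Prop :=
  match f in recfun k return k.-tuple nat -> nat -> Prop with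
  | RZero _ => fun _ y => y = 0
  | RSucc => fun v y => y = (thead v).+1
  | RProj _ i => fun v y => y = tnth v i
  | RComp _ m g h => fun v y =>
      exists w : m.-tuple nat,
        (forall i, eval (h i) v (tnth w i)) /\ eval g w y
  | RPrim _ f g => fun v y =>
      exists t : nat -> nat,
        [/\ eval f [tuple of behead v] (t 0),
            forall i, i < thead v ->
              eval g [tuple of i :: t i :: behead v] (t i.+1)
          & y = t (thead v)]
  | RMu _ f => fun v y =>
      eval f [tuple of y :: v] 0 /\
      forall z, z < y -> exists u, eval f [tuple of z :: v] u.+1
  end.

(** The decision problem "given an instance [x], does [P x] hold?" has an
    algorithm.  Nothing is required of the algorithm on numbers that do not
    code an instance; it may diverge there. *)
Definition decidable_problem (T : Type) (code : T -> nat)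
    (instance P : T -> Prop) : Prop :=
  exists f : recfun 1, forall x, instance x ->
    (P x -> eval f [tuple code x] 1) /\ (~ P x -> eval f [tuple code x] 0).

(** [Trans i] are the three distinguished binary predicates; [Rel k n] is the
    [n]-th of the other predicates of arity [k]. *)
Inductive symbol : Type :=
| Trans (i : 'I_3)
| Rel (k n : nat).

Definition arity (s : symbol) : nat :=
  match s with Trans _ => 2 | Rel k _ => k end.

(** The number [i] stands for the variable x_i. *)
Inductive formula : Type :=
| Atom (s : symbol) (a : (arity s).-tuple nat)
| Not (p : formula)
| And (p q : formula)
| Or (p q : formula)
| Imp (p q : formula)
| Ex (x : nat) (p : formula)
| All (x : nat) (p : formula).

Inductive fluted : nat -> formula -> Prop :=
| fluted_atom m l s (a : (arity s).-tuple nat) :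
    0 < l -> l + arity s = m.+1 -> a = iota l (arity s) :> seq nat ->
    fluted m (Atom a)
| fluted_not m p : fluted m p -> fluted m (Not p)
| fluted_and m p q : fluted m p -> fluted m q -> fluted m (And p q)
| fluted_or m p q : fluted m p -> fluted m q -> fluted m (Or p q)
| fluted_imp m p q : fluted m p -> fluted m q -> fluted m (Imp p q)
| fluted_ex m p : fluted m.+1 p -> fluted m (Ex m.+1 p)
| fluted_all m p : fluted m.+1 p -> fluted m (All m.+1 p).

Definition FL (p : formula) : Prop := exists m, fluted m p.

(** All variables, free or bound. *)
Fixpoint vars (p : formula) : seq nat :=
  match p with
  | Atom s a => a
  | Not p => vars p
  | And p q | Or p q | Imp p q => vars p ++ vars q
  | Ex x p | All x p => x :: vars p
  end.

Definition FL2 (p : formula) : Prop := FL p /\ size (undup (vars p)) <= 2.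

Definition interpretation (D : Type) : Type :=
  forall s : symbol, (arity s).-tuple D -> Prop.

Definition update (D : Type) (v : nat -> D) (x : nat) (d : D) : nat -> D :=
  fun y => if y == x then d else v y.

Fixpoint holds (D : Type) (I : interpretation D) (v : nat -> D) (p : formula)
    : Prop :=
  match p with
  | Atom s a => I s (map_tuple v a)
  | Not p => ~ holds I v p
  | And p q => holds I v p /\ holds I v q
  | Or p q => holds I v p \/ holds I v q
  | Imp p q => holds I v p -> holds I v q
  | Ex x p => exists d, holds I (update v x d) p
  | All x p => forall d, holds I (update v x d) p
  end.

(** Free variables are read existentially; the domain is nonempty because an
    assignment exists. *)
Definition satisfiable_3T (p : formula) : Prop :=
  exists (D : Type) (I : interpretation D) (v : nat -> D),
    (forall i, transitive D (fun x y => I (Trans i) [tuple x; y])) /\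
    holds I v p.

(** Goedel numbering, from Cantor's pairing function
    (x + y)(x + y + 1) / 2 + y. *)
Definition cpair (x y : nat) : nat := 'C((x + y).+1, 2) + y.

Definition code_seq (s : seq nat) : nat :=
  foldr (fun x c => (cpair x c).+1) 0 s.

Definition code_symbol (s : symbol) : nat :=
  match s with
  | Trans i => cpair 0 i
  | Rel k n => cpair 1 (cpair k n)
  end.

Fixpoint code_formula (p : formula) : nat :=
  match p with
  | Atom s a => cpair 0 (cpair (code_symbol s) (code_seq a))
  | Not p => cpair 1 (code_formula p)
  | And p q => cpair 2 (cpair (code_formula p) (code_formula q))
  | Or p q => cpair 3 (cpair (code_formula p) (code_formula q))
  | Imp p q => cpair 4 (cpair (code_formula p) (code_formula q))
  | Ex x p => cpair 5 (cpair x (code_formula p))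
  | All x p => cpair 6 (cpair x (code_formula p))
  end.

Lemma cpair_inj x y x' y' : cpair x y = cpair x' y' -> x = x' /\ y = y'.
Proof.
have lt u v u' v' : u + v < u' + v' -> cpair u v < cpair u' v'.
  move=> h; rewrite /cpair; apply: (@leq_trans 'C((u + v).+2, 2)).
    by rewrite [X in _ < X]binS bin1; lia.
  by apply: leq_trans (leq_addr _ _); apply: leq_bin2l.
move=> e; have s : x + y = x' + y'.
  case: (ltngtP (x + y) (x' + y')) => // /lt; by rewrite e ltnn.
by move: e; rewrite /cpair s => /addnI e; split=> //; lia.
Qed.

Lemma code_seq_inj : injective code_seq.
Proof. by elim=> [|x s IH] [|y t] //= [] /cpair_inj [-> /IH ->]. Qed.

Lemma code_symbol_inj : injective code_symbol.
Proof.
move=> [i|k n] [j|l o] /= /cpair_inj [] //.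
  by move=> _ /val_inj ->.
by move=> _ /cpair_inj [-> ->].
Qed.

Lemma code_formula_inj : injective code_formula.
Proof.
elim=> [s a|p IH|p IHp q IHq|p IHp q IHq|p IHp q IHq|x p IH|x p IH];
  case=> [s' a'|p'|p' q'|p' q'|p' q'|x' p'|x' p'] /= /cpair_inj [] // _.
- case/cpair_inj=> /code_symbol_inj e; case: _ / e a' => a'.
  by move=> /code_seq_inj /val_inj ->.
- by move=> /IH ->.
- by case/cpair_inj=> /IHp -> /IHq ->.
- by case/cpair_inj=> /IHp -> /IHq ->.
- by case/cpair_inj=> /IHp -> /IHq ->.
- by case/cpair_inj=> -> /IH ->.
- by case/cpair_inj=> -> /IH ->.
Qed.

(* Main.v *)
From mathcomp Require Import all_boot zify.
From Stdlib Require Import ClassicalEpsilon IndefiniteDescription.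
From Stdlib Require Import Relations.Relation_Definitions.
Require Import Defs.

Set Implicit Arguments.
Unset Strict Implicit.
Unset Printing Implicit Defensive.

(** Runs of register machines are encoded.  A register holding [v] at a time [d]
    is the set of positions [j >= 2v+4] in an infinite column of elements, stored
    as the pairs (d, j) of a transitive relation.  Transitivity along an edge from
    [d] to the next time point copies non-membership forward in time; transitivity
    along an edge from [j] to [j+1] makes a set upward closed.  Three relations,
    two of which hold complementary sets at any moment, suffice to copy all
    registers exactly and to change some of them by one.

    If [f] decided satisfiability, let a machine [M] compute, on input [n], the
    answer of [f] on the formula "[M'] runs forever on input [n]", where [n] is the
    code of the encoding of [M'], and halt iff that answer is 1.  Taking [M'] = [M]
    gives a contradiction.  The input is loaded by a chain of increments, so the
    formula is a computable function of [n]. *)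

(** * Compiling recursive functions to register machines *)

(** Comparing two successive rows at a column element involves three elements, out of reach of two
    variables; transitivity is the only condition that relates three elements at once. It yields
    mere inclusions, so equality of rows has to come from pairs of complementary rows. The fluted
    order adds its own limit: under a quantifier on x_2 an atom sees x_2 alone or the pair (x_1,
    x_2), never x_1 alone or the converse pair, so every test on x_1 is made before x_2 is
    quantified.

    The constants come from the update. A threshold is forced to move only through its parity, so
    values are counted in steps of two. As v and the new value v' differ by at most one, an even
    threshold from 2v'+2 up to 2v+4 is one of 2v'+2, 2v'+4, 2v'+6; these are told apart modulo 6,
    which is why column labels are periodic modulo 6 and values are labelled modulo 3. *)

Definition store := nat -> nat.

Definition upd (s : store) (r x : nat) : store :=
  fun y => if y == r then x else s y.

Inductive instr : Type :=
| Inc (r q : nat)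
| Dec (r q z : nat)
| Jmp (q : nat).

Definition config : Type := nat * store.

Definition step (code : nat -> instr) (c : config) : config :=
  match code c.1 with
  | Inc r q => (q, upd c.2 r (c.2 r).+1)
  | Dec r q z => if c.2 r is x.+1 then (q, upd c.2 r x) else (z, c.2)
  | Jmp q => (q, c.2)
  end.

Definition reaches code c c' := exists n, iter n (step code) c = c'.

Lemma reaches_refl code c : reaches code c c.
Proof. by exists 0. Qed.

Lemma reaches_trans code c1 c2 c3 :
  reaches code c1 c2 -> reaches code c2 c3 -> reaches code c1 c3.
Proof. by move=> [n <-] [m <-]; exists (m + n); rewrite iterD. Qed.

(** [DWhile r c] is "while r > 0 do (r := r - 1; c)". *)
Inductive cmd : Type :=
| Skip
| CInc (r : nat)
| Seq (c d : cmd)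
| DWhile (r : nat) (c : cmd).

Inductive exec : cmd -> store -> store -> Prop :=
| exec_skip s : exec Skip s s
| exec_inc r s : exec (CInc r) s (upd s r (s r).+1)
| exec_seq c d s1 s2 s3 : exec c s1 s2 -> exec d s2 s3 -> exec (Seq c d) s1 s3
| exec_done r c s : s r = 0 -> exec (DWhile r c) s s
| exec_loop r c x s1 s2 s3 : s1 r = x.+1 -> exec c (upd s1 r x) s2 ->
    exec (DWhile r c) s2 s3 -> exec (DWhile r c) s1 s3.

Fixpoint flat (c : cmd) (p : nat) : seq instr :=
  match c with
  | Skip => [::]
  | CInc r => [:: Inc r p.+1]
  | Seq c d => let l := flat c p in l ++ flat d (p + size l)
  | DWhile r c =>
      let l := flat c p.+1 in
      Dec r p.+1 (p + size l).+2 :: rcons l (Jmp p)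
  end.

Definition code_at (code : nat -> instr) p l :=
  forall i, i < size l -> code (p + i) = nth (Jmp 0) l i.

Lemma code_at_cat code p l1 l2 :
  code_at code p (l1 ++ l2) ->
  code_at code p l1 /\ code_at code (p + size l1) l2.
Proof.
move=> h; split=> i hi.
  by rewrite h ?size_cat ?ltn_addr // nth_cat hi.
by rewrite -addnA h ?size_cat ?ltn_add2l // nth_cat ltnNge leq_addr addKn.
Qed.

Lemma exec_reaches code c s s' : exec c s s' ->
  forall p, code_at code p (flat c p) ->
  reaches code (p, s) (p + size (flat c p), s').
Proof.
elim=> {c s s'} [s|r s|c d s1 s2 s3 _ IHc _ IHd|r c s h0|
  r c x s1 s2 s3 hx _ IHc _ IHl] p hp.
- by rewrite /= addn0; apply: reaches_refl.
- exists 1; rewrite /= /step -[p in code p]addn0 (hp 0) //=.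
  by rewrite addn1.
- have [h1 h2] := code_at_cat hp.
  rewrite size_cat addnA; apply: reaches_trans (IHc _ h1) _.
  exact: IHd.
- exists 1; rewrite /= /step -[p in code p]addn0 (hp 0) //= h0.
  by rewrite size_rcons !addnS.
- apply: reaches_trans (IHl _ hp).
  have [_ h] := @code_at_cat _ _ [:: _] _ hp.
  move: h; rewrite -cats1 addn1 => /code_at_cat[h1 h2].
  apply: (@reaches_trans _ _ (p.+1, upd s1 r x)).
    by exists 1; rewrite /= /step -[p in code p]addn0 (hp 0) //= hx.
  apply: reaches_trans (IHc _ h1) _; exists 1.
  by rewrite /= /step -[X in code X]addn0 (h2 0).
Qed.

(** The counter is its own variant: as the body must hand [r] back with the decremented value,
    termination follows by induction on it, and [R] is an invariant indexed by the rounds left. *)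
Lemma exec_dwhile r c (R : store -> nat -> Prop) s :
  (forall n s1, R s1 n.+1 -> s1 r = n.+1 -> exists s2,
     [/\ exec c (upd s1 r n) s2, R s2 n & s2 r = n]) ->
  R s (s r) -> exists s', [/\ exec (DWhile r c) s s', R s' 0 & s' r = 0].
Proof.
move=> hc; move e: (s r) => n; elim: n s e => [|n IH] s e hs.
  by exists s; split=> //; apply: exec_done.
have [s2 [h1 h2 h3]] := hc _ _ hs e.
have [s' [h4 h5 h6]] := IH _ h3 h2.
by exists s'; split=> //; apply: exec_loop e h1 h4.
Qed.

Definition clear r := DWhile r Skip.

Lemma exec_clear r s : exists s', exec (clear r) s s' /\ s' =1 upd s r 0.
Proof.
have [||s'] := @exec_dwhile r Skip (fun s1 n => forall x, x != r -> s1 x = s x) s.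
- move=> n s1 h e; exists (upd s1 r n); split; first exact: exec_skip.
    by move=> x hx; rewrite /upd (negPf hx) h.
  by rewrite /upd eqxx.
- by [].
move=> [h1 h2 h3]; exists s'; split=> // x; rewrite /upd.
by case: eqP => [->//|/eqP]; apply: h2.
Qed.

Definition move a b := DWhile a (CInc b).

Lemma exec_move a b s : a != b ->
  exists s', exec (move a b) s s' /\ s' =1 upd (upd s b (s b + s a)) a 0.
Proof.
move=> ab.
have [||s'] := @exec_dwhile a (CInc b) (fun s1 n => s1 b + n = s b + s a /\
    forall x, x != a -> x != b -> s1 x = s x) s.
- move=> n s1 [h1 h2] e; eexists; split; first exact: exec_inc.
    split=> [|x xa xb]; first by rewrite /upd eqxx eq_sym (negPf ab); lia.
    by rewrite /upd (negPf xa) (negPf xb) h2.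
  by rewrite /upd eqxx (negPf ab).
- by split.
move=> [h1 [h2 h3] h4]; exists s'; split=> // x; rewrite /upd.
case: (eqVneq x a) => [->//|xa]; case: (eqVneq x b) => [->|xb].
  by rewrite -h2 addn0.
exact: h3.
Qed.

Definition copy a b tmp := Seq (DWhile a (Seq (CInc b) (CInc tmp))) (move tmp a).

Lemma exec_copy a b tmp s : a != b -> a != tmp -> b != tmp -> s tmp = 0 ->
  exists s', exec (copy a b tmp) s s' /\ s' =1 upd s b (s b + s a).
Proof.
move=> ab at_ bt t0.
have [||s1] := @exec_dwhile a (Seq (CInc b) (CInc tmp))
  (fun s1 n => [/\ s1 b + n = s b + s a, s1 tmp + n = s a &
    forall x, x != a -> x != b -> x != tmp -> s1 x = s x]) s.
- move=> n s1 [h1 h2 h3] e; eexists; split.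
      by apply: exec_seq; apply: exec_inc.
    split=> [||x xa xb xt].
    + by rewrite /upd !eqxx (negPf bt) [b == a]eq_sym (negPf ab); lia.
    + rewrite /upd !eqxx [tmp == b]eq_sym (negPf bt).
      by rewrite [tmp == a]eq_sym (negPf at_); lia.
    + by rewrite /upd (negPf xa) (negPf xb) (negPf xt) h3.
  by rewrite /upd eqxx (negPf ab) (negPf at_).
- by rewrite t0.
move=> [h1 [h2 h3 h4] h5].
have ta : tmp != a by rewrite eq_sym.
have [s2 [h6 h7]] := exec_move s1 ta.
exists s2; split; first exact: exec_seq h1 h6.
move=> x; rewrite h7 /upd.
case: (eqVneq x tmp) => [->|xt]; first by rewrite eq_sym (negPf bt) t0.
case: (eqVneq x a) => [->|xa]; first by rewrite (negPf ab); lia.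
by case: (eqVneq x b) => [->|xb]; [lia|exact: h4].
Qed.

Definition seqs := foldr Seq Skip.

(** Arguments are in the registers [a], the result goes to [out], and the
    registers from [b] on are scratch, holding 0 before and after. *)
Fixpoint compile k (f : recfun k) (a : seq nat) (out b : nat) : cmd :=
  match f with
  | RZero _ => Skip
  | RSucc => Seq (copy (nth 0 a 0) out b) (CInc out)
  | RProj _ i => copy (nth 0 a i) out b
  | RComp _ m g h =>
      Seq (seqs [seq compile (h i) a (b + i) (b + m) | i <- enum 'I_m])
     (Seq (compile g (iota b m) out (b + m))
          (seqs [seq clear i | i <- iota b m]))
  | RPrim _ f g =>
      Seq (compile f (behead a) out b.+3)
     (Seq (copy (nth 0 a 0) b b.+3)
     (Seq (DWhile b
            (Seq (compile g [:: b.+1, out & behead a] b.+2 b.+3)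
            (Seq (clear out)
            (Seq (move b.+2 out) (CInc b.+1)))))
          (clear b.+1)))
  | RMu _ f =>
      Seq (compile f (out :: a) b b.+1)
          (DWhile b (Seq (clear b) (Seq (CInc out) (compile f (out :: a) b b.+1))))
  end.

Definition clean (b : nat) (s : store) := forall r, b <= r -> s r = 0.

(** Correctness goes from a value of [eval] to a terminating execution: a decision procedure has a
    value on every instance it is applied to. Stores are specified up to [=1], being functions built
    by different updates. *)
Definition compiled k (f : recfun k) := forall a out b s (v : k.-tuple nat) y,
  map s a = v -> {in a, forall r, r < b} -> out < b -> out \notin a ->
  s out = 0 -> clean b s -> eval f v y ->
  exists s', exec (compile f a out b) s s' /\ s' =1 upd s out y.

Lemma exec_clears l s : exists s', exec (seqs [seq clear i | i <- l]) s s' /\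
  s' =1 fun r => if r \in l then 0 else s r.
Proof.
elim: l s => [|r l IH] s /=; first by exists s; split=> //; apply: exec_skip.
have [s1 [h1 h2]] := exec_clear r s.
have [s2 [h3 h4]] := IH s1.
exists s2; split; first exact: exec_seq h1 h3.
by move=> x; rewrite h4 h2 inE /upd; case: eqP => //=; case: ifP.
Qed.

Lemma compile_comp k m (g : recfun m) (h : 'I_m -> recfun k) :
  compiled g -> (forall i, compiled (h i)) -> compiled (RComp g h).
Proof.
move=> Hg Hh a out b s v y ea ab ob oa s0 cl /= [w [hw hg]].
have [s1 [e1 h1]] : exists s1,
    exec (seqs [seq compile (h i) a (b + i) (b + m) | i <- enum 'I_m]) s s1 /\
    s1 =1 fun r => if (b <= r < b + m) then nth 0 w (r - b) else s r.
  (* Generalized from [enum 'I_m] to any duplicate-free [l], so that only the output registers still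
     to be filled are assumed to be 0. *)
  have : forall l : seq 'I_m, uniq l -> forall s,
      map s a = v -> (forall i, i \in l -> s (b + i) = 0) -> clean (b + m) s ->
      exists s1,
        exec (seqs [seq compile (h i) a (b + i) (b + m) | i <- l]) s s1 /\
        s1 =1 fun r => if r \in [seq b + i | i : 'I_m <- l]
                       then nth 0 w (r - b) else s r.
    elim=> [|i l IH] /= => [_ t _ _ _|/andP[il ul] t et t0 ct].
      by exists t; split=> //; apply: exec_skip.
    have [||||t1 [e1 h1]] := Hh i a (b + i) (b + m) t v (tnth w i) et _ _ _ _ ct (hw i).
    + by move=> r /ab; lia.
    + by rewrite ltn_add2l.
    + by apply/negP => /ab; lia.
    + by apply: t0; rewrite mem_head.
    have [|||t2 [e2 h2]] := IH ul t1.
    + rewrite -et; apply/eq_in_map => r /ab hr; rewrite h1 /upd.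
      by case: eqP => // ?; lia.
    + move=> j jl; rewrite h1 /upd eqn_add2l.
      case: eqP => [/val_inj ji|_]; first by rewrite -ji jl in il.
      by apply: t0; rewrite inE jl orbT.
    + move=> r hr; rewrite h1 /upd; case: eqP => [er|_]; last exact: ct.
      by have := ltn_ord i; lia.
    exists t2; split; first exact: exec_seq e1 e2.
    move=> r; rewrite h2 inE h1 /upd; case: eqP => //= ->.
    by rewrite addKn -tnth_nth if_same.
  move/(_ (enum 'I_m) (enum_uniq _) s ea)=> [||s1 [e1 h1]].
  + by move=> i _; apply: cl; rewrite leq_addr.
  + by move=> r hr; apply: cl; lia.
  exists s1; split=> // r; rewrite h1; congr (if _ then _ else _).
  apply/mapP/idP => [[i _ ->]|hr]; first by have := ltn_ord i; lia.
  have lt : r - b < m by lia.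
  by exists (Ordinal lt); rewrite ?mem_enum //=; lia.
have [||||||s2 [e2 h2]] := Hg (iota b m) out (b + m) s1 w y _ _ _ _ _ _ hg.
- apply: (@eq_from_nth _ 0); first by rewrite size_map size_iota size_tuple.
  move=> i; rewrite size_map size_iota => im.
  rewrite (nth_map 0) ?size_iota // nth_iota // h1 leq_addr ltn_add2l im.
  by rewrite addKn.
- by move=> r; rewrite mem_iota; lia.
- by lia.
- by rewrite mem_iota; lia.
- by rewrite h1; case: ifP => //; lia.
- by move=> r hr; rewrite h1; case: ifP => [|_]; [lia|apply: cl; lia].
have [s3 [e3 h3]] := exec_clears (iota b m) s2.
exists s3; split; first exact: exec_seq e1 (exec_seq e2 e3).
move=> r; rewrite h3 h2 /upd h1 mem_iota; case: ifP => hr.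
  by case: eqP => [|_]; [lia|rewrite cl //; lia].
by rewrite hr.
Qed.

(** Register [b] counts the remaining rounds down and [b.+1] the index up, while [out] holds the
    current value. As [g] reads [out], its result is first put in [b.+2] and then moved. *)
Lemma compile_prim k (f : recfun k) (g : recfun k.+2) :
  compiled f -> compiled g -> compiled (RPrim f g).
Proof.
move=> Hf Hg a out b s v y ea ab ob oa s0 cl /= [t [h0 ht ->]].
have sa : size a = k.+1 by rewrite -(size_map s) ea size_tuple.
have ht0 : thead v = s (nth 0 a 0).
  by rewrite /thead (tnth_nth 0) -ea (nth_map 0) // sa.
case: a sa ea ab oa ht0 => [//|a0 a] [sa] ea ab oa /= ht0.
have eb : map s a = behead v by rewrite -ea.
have ab' : {in a, forall r, r < b} by move=> r hr; apply: ab; rewrite inE hr orbT.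
have a0b : a0 < b by apply: ab; rewrite mem_head.
have [oa0 oa'] : out != a0 /\ out \notin a.
  by move: oa; rewrite inE negb_or => /andP.
have [|||s1 [e1 h1]] := Hf a out b.+3 s [tuple of behead v] _ eb _ _ oa' s0 _ h0.
- by move=> r /ab'; lia.
- by lia.
- by move=> r hr; apply: cl; lia.
have [||||s2 [e2 h2]] := @exec_copy a0 b b.+3 s1.
- by lia.
- by lia.
- by lia.
- by rewrite h1 /upd; case: eqP => [|_]; [lia|apply: cl; lia].
have s2b : s2 b = thead v.
  rewrite h2 /upd eqxx !h1 /upd ht0.
  rewrite (_ : b == out = false); last by lia.
  by rewrite [a0 == out]eq_sym (negPf oa0) cl.
pose R (u : store) n := [/\ n <= thead v, u b.+1 = thead v - n,
  u out = t (thead v - n) & forall r, r != out -> r != b -> r != b.+1 -> u r = s r].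
have := @exec_dwhile b (Seq (compile g [:: b.+1, out & a] b.+2 b.+3)
  (Seq (clear out) (Seq (move b.+2 out) (CInc b.+1)))) R s2.
case.
- move=> n u [r1 r2 r3 r4] ub; pose i := thead v - n.+1.
  have it : i < thead v by rewrite /i; lia.
  pose u0 := upd u b n.
  have u0E r : r < b -> r != out -> u0 r = s r.
    by move=> rb ro; rewrite /u0 /upd; case: eqP => [|_]; [lia|apply: r4; lia].
  have [||||||u1 [f1 g1]] := Hg [:: b.+1, out & a] b.+2 b.+3 u0 _ _ _ _ _ _ _ _ (ht i it).
  + rewrite /= {1 2}/u0 /upd (_ : b.+1 == b = false); last by lia.
    rewrite (_ : out == b = false); last by lia.
    rewrite r2 r3 -eb; congr [:: _, _ & _].
    apply/eq_in_map => r hr; apply: u0E; first exact: ab'.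
    by apply/eqP => er; rewrite -er hr in oa'.
  + by move=> r; rewrite !inE => /or3P[/eqP->|/eqP->|/ab'] //; lia.
  + by [].
  + rewrite !inE !negb_or; apply/and3P; split; [by lia|by lia|].
    by apply/negP => /ab'; lia.
  + by rewrite /u0 /upd; case: eqP => [|_]; [lia|rewrite r4 ?cl; lia].
  + move=> r hr; rewrite /u0 /upd; case: eqP => [|_]; [lia|rewrite r4 ?cl; lia].
  have [u2 [f2 g2]] := exec_clear out u1.
  have [|u3 [f3 g3]] := @exec_move b.+2 out u2; first by lia.
  exists (upd u3 b.+1 (u3 b.+1).+1); split.
  + apply: exec_seq f1 (exec_seq f2 (exec_seq f3 _)); exact: exec_inc.
  + have E r : upd u3 b.+1 (u3 b.+1).+1 r =
        if r == b.+1 then (thead v - n) else if r == out then t (i.+1) else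
        if r == b then n else if r == b.+2 then 0 else u r.
      rewrite /upd !g3 /upd !g2 /upd !g1 /upd /u0 /upd !eqxx.
      case: (eqVneq r b.+1) => [_|nb1].
        do !(case: eqP => ?; try lia).
      case: (eqVneq r out) => [ro|no].
        do !(case: eqP => ?; try lia).
      do !(case: eqP => ?; try lia).
    have ii : i.+1 = thead v - n by rewrite /i; lia.
    split; first by lia.
    - by rewrite E eqxx.
    - by rewrite E eqxx (_ : out == b.+1 = false) -?ii //; lia.
    - move=> r q1 q2 q3; rewrite E (negPf q1) (negPf q2) (negPf q3).
      by case: eqP => [->|_]; [rewrite (cl b.+2) //; lia|apply: r4].
  + rewrite /upd (_ : b == b.+1 = false); last by lia.
    rewrite g3 /upd (_ : b == b.+2 = false); last by lia.
    rewrite (_ : b == out = false); last by lia.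
    rewrite g2 /upd (_ : b == out = false); last by lia.
    rewrite g1 /upd (_ : b == b.+2 = false); last by lia.
    by rewrite /u0 /upd eqxx.
- rewrite s2b /R subnn; split=> //.
  + rewrite h2 /upd (_ : b.+1 == b = false) ?h1 /upd; last by lia.
    by rewrite (_ : b.+1 == out = false) ?(cl b.+1) //; lia.
  + by rewrite h2 /upd (_ : out == b = false) ?h1 /upd ?eqxx //; lia.
  + by move=> r q1 q2 q3; rewrite h2 /upd (negPf q2) h1 /upd (negPf q1).
move=> s3 [e3 [_ r2 r3 r4] s3b].
have [s4 [e4 h4]] := exec_clear b.+1 s3.
exists s4; split.
  exact: exec_seq e1 (exec_seq e2 (exec_seq e3 e4)).
move=> r; rewrite h4 /upd; case: (eqVneq r b.+1) => [->|n1].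
  by case: eqP => [|_]; [lia|rewrite cl].
case: (eqVneq r out) => [->|no]; first by rewrite r3 subn0.
by case: (eqVneq r b) => [->|nb]; [rewrite s3b cl|apply: r4].
Qed.

(** [out] is the candidate and [b] the value of [f] there. The loop only asks whether [b] is 0, so
    its body discards the rest of [b] before trying the next candidate; on exit [b] is clean
    again. *)
Lemma compile_mu k (f : recfun k.+1) : compiled f -> compiled (RMu f).
Proof.
move=> Hf a out b s v y ea ab ob oa s0 cl /= [hy hz].
have arg (u : store) z x : (forall r, r < b -> r != out -> u r = s r) ->
    u out = z -> u b = 0 -> clean b.+1 u ->
    eval f [tuple of z :: v] x ->
    exists u', exec (compile f (out :: a) b b.+1) u u' /\ u' =1 upd u b x.
  move=> hu uo ub cu; apply: Hf => //=.
  - rewrite uo -ea; congr (_ :: _); apply/eq_in_map => r hr.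
    by apply: hu; [exact: ab|apply/eqP => er; rewrite -er hr in oa].
  - by move=> r; rewrite inE => /orP[/eqP->|/ab]; lia.
  - by rewrite inE negb_or; apply/andP; split; [lia|apply/negP => /ab; lia].
have val z : z <= y ->
    exists2 x, eval f [tuple of z :: v] x & (x == 0) = (z == y).
  rewrite leq_eqVlt => /orP[/eqP->|zy]; first by exists 0; rewrite ?eqxx.
  by have [x hx] := hz _ zy; exists x.+1 => //; rewrite (ltn_eqF zy).
pose inv (u : store) z := [/\ forall r, r < b -> r != out -> u r = s r, u out = z,
  clean b.+1 u & (u b == 0) = (z == y)].
have loop z u : z <= y -> inv u (y - z) -> exists u',
    exec (DWhile b (Seq (clear b) (Seq (CInc out)
      (compile f (out :: a) b b.+1)))) u u' /\ inv u' y.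
  elim: z u => [|z IH] u zy [i1 i2 i3 i4].
    exists u; rewrite subn0 in i2 i4; split=> //; apply: exec_done.
    by apply/eqP; rewrite i4.
  case ub: (u b) i4 => [|x]; first by lia.
  move=> _.
  have [u1 [e1 h1]] := exec_clear b (upd u b x).
  have [|x' hx' ex'] := val (y - z); first by lia.
  pose u2 := upd u1 out (u1 out).+1.
  have u2E r : u2 r = if r == out then y - z else if r == b then 0 else u r.
    rewrite /u2 /upd !h1 /upd; do 3?case: eqP => ?; lia.
  have [||||u3 [e3 h3]] := arg u2 (y - z) x' _ _ _ _ hx'.
  - move=> r rb ro; rewrite u2E (negPf ro); case: eqP => [|_]; [lia|exact: i1].
  - by rewrite u2E eqxx.
  - by rewrite u2E eqxx; case: eqP => //; lia.
  - move=> r hr; rewrite u2E; do 2?case: eqP => ?; try lia; exact: i3.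
  have [||u4 [e4 h4]] := IH u3; first by lia.
    split.
    - move=> r rb ro; rewrite h3 /upd u2E (negPf ro).
      by case: eqP => [|_]; [lia|exact: i1].
    - by rewrite h3 /upd u2E eqxx; case: eqP => //; lia.
    - move=> r hr; rewrite h3 /upd u2E; do 3?case: eqP => ?; try lia; exact: i3.
    - by rewrite h3 /upd eqxx.
  exists u4; split=> //.
  apply: exec_loop ub _ e4.
  exact: exec_seq e1 (exec_seq (exec_inc _ _) e3).
have [x hx ex] := val 0 (leq0n _).
have [||||s1 [e1 h1]] := arg s 0 x _ _ _ _ hx.
- by [].
- by [].
- exact: cl.
- by move=> r hr; apply: cl; lia.
have [||s2 [e2 [i1 i2 i3 i4]]] := loop y s1; first by [].
  rewrite subnn; split.
  - by move=> r rb ro; rewrite h1 /upd; case: eqP => //; lia.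
  - by rewrite h1 /upd; case: eqP => //; lia.
  - by move=> r hr; rewrite h1 /upd; case: eqP => [|_]; [lia|apply: cl; lia].
  - by rewrite h1 /upd eqxx.
exists s2; split; first exact: exec_seq e1 e2.
move=> r; rewrite /upd; case: eqP => [->//|/eqP ro].
case: (ltngtP r b) => [rb|rb|->]; first exact: i1.
  by rewrite i3 ?cl //; lia.
by rewrite cl //; apply/eqP; rewrite i4 eqxx.
Qed.

Lemma compileP k (f : recfun k) : compiled f.
Proof.
elim: k / f => [k||k i|k m g Hg h Hh|k f Hf g Hg|k f Hf].
- move=> a out b s v y _ _ _ _ s0 _ /= ->; exists s; split; first exact: exec_skip.
  by move=> r; rewrite /upd; case: eqP => [->|].
- move=> a out b s v y ea ab ob oa s0 cl /= ->.
  have sa : size a = 1 by rewrite -(size_map s) ea size_tuple.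
  case: a sa ea ab oa => [|a0 []] //= _ ea ab oa.
  have a0b : a0 < b by apply: ab; rewrite mem_head.
  rewrite inE in oa.
  have [||||s1 [e1 h1]] := @exec_copy a0 out b s.
  + by rewrite eq_sym.
  + by lia.
  + by lia.
  + exact: cl.
  eexists; split; first exact: exec_seq e1 (exec_inc _ _).
  move=> r; rewrite /upd !h1 /upd eqxx; case: eqP => // _.
  by rewrite s0 /thead (tnth_nth 0) -ea.
- move=> a out b s v y ea ab ob oa s0 cl /= ->.
  have ia : i < size a by rewrite -(size_map s) ea size_tuple.
  have ai := mem_nth 0 ia.
  have [||||s1 [e1 h1]] := @exec_copy (nth 0 a i) out b s.
  + by apply/eqP => e; rewrite -e ai in oa.
  + by rewrite ltn_eqF // ab.
  + by lia.
  + exact: cl.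
  exists s1; split=> // r; rewrite h1 s0 (tnth_nth 0) -ea (nth_map 0) //.
- exact: compile_comp.
- exact: compile_prim.
- exact: compile_mu.
Qed.

(** * Machines that load their own input *)

Definition relabel (i : instr) : instr :=
  match i with
  | Inc r q => Inc r q.*2
  | Dec r q z => Dec r q.*2 z.*2
  | Jmp q => Jmp q.*2
  end.

(** Even states are the program counters of [P], and those outside [P] loop.
    Started in the odd state [n.*2.+1] with empty registers, the machine loads
    [n] into register 0 and enters [P] at its first instruction. *)
Definition machine (P : seq instr) (q : nat) : instr :=
  if odd q then (if q == 1 then Jmp 0 else Inc 0 (q - 2))
  else relabel (nth (Jmp q./2) P q./2).

Definition run P n t : config := iter t (step (machine P)) (n.*2.+1, fun=> 0).

Definition halts P n := exists t, (run P n t).1 = (size P).*2.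

Lemma machine_even P q : machine P q.*2 = relabel (nth (Jmp q) P q).
Proof. by rewrite /machine odd_double doubleK. Qed.

Lemma load_input P n : exists t s, run P n t = (0, s) /\ s =1 upd (fun=> 0) 0 n.
Proof.
suff h m i (s : store) : s =1 upd (fun=> 0) 0 i -> exists t s',
    iter t (step (machine P)) (m.*2.+1, s) = (0, s') /\ s' =1 upd (fun=> 0) 0 (i + m).
  have [|t [s []]] := h n 0 (fun=> 0); first by move=> r; rewrite /upd if_same.
  by exists t, s.
elim: m i s => [|m IH] i s hs.
  by exists 1, s; rewrite addn0; split.
have [|t [s' [h1 h2]]] := IH i.+1 (upd s 0 (s 0).+1).
  by move=> r; rewrite /upd !hs /upd; case: eqP.
exists t.+1, s'; rewrite -addSnnS; split=> //.
rewrite iterSr -h1; congr (iter t _ _).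
by rewrite /step /machine /= odd_double /= subn2.
Qed.

Lemma reaches_relabel P c c' : reaches (fun q => nth (Jmp q) P q) c c' ->
  reaches (machine P) (c.1.*2, c.2) (c'.1.*2, c'.2).
Proof.
move=> [t <-]; elim: t c => [|t IH] c; first exact: reaches_refl.
rewrite iterSr; apply: reaches_trans (IH _); exists 1.
rewrite /= /step machine_even.
by case: (nth _ P c.1) => [r q|r q z|q] //=; case: (c.2 r).
Qed.

Lemma recfun_machine (g : recfun 1) : exists P, forall n,
  (eval g [tuple n] 1 -> halts P n) /\ (eval g [tuple n] 0 -> ~ halts P n).
Proof.
pose l := flat (compile g [:: 0] 1 2) 0; pose p := size l.
(* The appended instruction tests the output register 1: a positive answer leaves [P] and halts,
   answer 0 repeats the test forever. *)
pose P := rcons l (Dec 1 p.+1 p); exists P => n.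
have sP : size P = p.+1 by rewrite size_rcons.
have lP : nth (Jmp p) P p = Dec 1 p.+1 p by rewrite nth_rcons ltnn eqxx.
have main y : eval g [tuple n] y -> exists t s, run P n t = (p.*2, s) /\ s 1 = y.
  move=> hy; have [t [s [h1 h2]]] := load_input P n.
  have [||||||s1 [e1 h3]] := @compileP _ g [:: 0] 1 2 s [tuple n] y _ _ _ _ _ _ hy.
  - by rewrite /= h2.
  - by move=> r; rewrite inE => /eqP->.
  - by [].
  - by [].
  - by rewrite h2.
  - by move=> [|[|r]] //; rewrite h2.
  have [|m hm] := @reaches_relabel P (0, s) (0 + p, s1).
    apply: (exec_reaches e1) => i hi; rewrite add0n nth_rcons hi.
    by apply: set_nth_default.
  by exists (m + t), s1; rewrite /run iterD -/(run P n t) h1; split=> //; rewrite h3.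
have hlt t s : run P n t = (p.*2, s) -> run P n t.+1 =
   step (machine P) (p.*2, s) by move=> e; rewrite /run iterS -/(run P n t) e.
split=> /main[t [s [h1 h2]]].
  by exists t.+1; rewrite (hlt _ _ h1) /step machine_even lP /= h2 sP.
have stuck j : run P n (j + t) = (p.*2, s).
  elim: j => [//|j IH]; rewrite addSn (hlt _ _ IH).
  by rewrite /step machine_even lP /= h2.
move=> [u hu].
have absorb j : (run P n (j + u)).1 = (size P).*2.
  elim: j => [//|j IH]; rewrite addSn /run iterS -/(run P n _) /step IH.
  by rewrite machine_even nth_default.
by have := absorb t; rewrite addnC stuck /= sP; lia.
Qed.

(** * The formula *)

Inductive class := State | Column | Value | Op | Phase | Start.

Definition class_index (c : class) : nat :=
  match c with
  | State => 0 | Column => 1 | Value => 2 | Op => 3 | Phase => 4 | Start => 5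
  end.

(** Residues modulo 8 keep the six classes apart; with a power of two the multiplication is three
    doublings in [computable_unary]. *)
Definition unary (c : class) (i : nat) : symbol := Rel 1 (i * 8 + class_index c).

Definition P1 c i : formula := @Atom (unary c i) [tuple 1].
Definition P2 c i : formula := @Atom (unary c i) [tuple 2].
Definition Succ : formula := @Atom (Rel 2 0) [tuple 1; 2].

Definition t1 : 'I_3 := inord 0.
Definition t2 : 'I_3 := inord 1.
Definition t3 : 'I_3 := inord 2.
Definition Edge (i : 'I_3) : formula := @Atom (Trans i) [tuple 1; 2].

(** A nullary atom is fluted at every level, so the same formula ends conjunctions about x_1 and
    conjunctions about x_2. *)
Definition Truth : formula :=
  let p := @Atom (Rel 0 0) [tuple] in Imp p p.

Definition Next (p : formula) : formula := All 2 (Imp Succ p).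

Definition forall_in (A : Type) (s : seq A) (F : A -> formula) : formula :=
  foldr (fun x p => And (F x) p) Truth s.

Definition below n := forall_in (iota 0 n).

(** Along a column the row of a relation is upward closed wherever that relation
    has an edge.  A row holding the complement [j < c] of a threshold therefore
    forces [c] to be even for [t2] and odd for [t3]; the edges of [t1] are
    everywhere. *)
Definition column_edge (i : nat) : 'I_3 := if odd i then t3 else t2.

(** Label [i < 5] marks exactly the [i]-th element; the labels [5..10] cycle, so
    that every label is congruent to its position modulo 6. *)
Definition next_column (i : nat) : nat := if i == 10 then 5 else i.+1.

Definition column_index r i := r * 11 + i.
Definition value_index r l := r * 3 + l.

Definition columns r : formula :=
  And (Ex 1 (P1 Column (column_index r 0)))
      (below 11 (fun i => All 1 (Imp (P1 Column (column_index r i))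
         (Next (And (P2 Column (column_index r (next_column i)))
                    (And (Edge t1) (Edge (column_edge i)))))))).

(** A relation with an edge from one time point to the next can only shrink its
    row, so two relations holding complementary rows copy the row exactly.  Two
    consecutive edges share a single relation, which leaves room for changes in
    one direction at the point in between. *)
Definition time_edges (s : nat) : seq 'I_3 :=
  nth [:: t1; t2] [:: [:: t1; t2]; [:: t2; t3]; [:: t1; t2]; [:: t1; t3]] s.

Definition phases : formula :=
  below 4 (fun s => All 1 (Imp (P1 Phase s)
    (Next (And (P2 Phase (s.+1 %% 4)) (forall_in (time_edges s) Edge))))).

(** The pairs of relations required to be complementary in phase [s], on columns
    of residue [i], when the current value is [l] modulo 3.  A row may change only
    where the pair of the incoming edge is not required. *)
Definition opposites (s i l : nat) : seq ('I_3 * 'I_3) :=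
  match s with
  | 0 => (t1, t2) :: (if i == (2 * l + 3) %% 6 then [::] else [:: (t1, t3)])
  | 1 => (t3, t2) :: (if i == (2 * l + 1) %% 6 then [:: (t1, t2)] else [::])
  | 2 => [:: (t1, t2); (t3, t2)]
  | _ => (t1, t3) :: (if i == (2 * l + 2) %% 6 then [::] else [:: (t1, t2)])
  end.

Definition opposite (p : 'I_3 * 'I_3) : formula :=
  And (Imp (Edge p.1) (Not (Edge p.2))) (Imp (Not (Edge p.2)) (Edge p.1)).

Definition entries r : formula :=
  below 4 (fun s => below 3 (fun l => below 11 (fun i =>
    All 1 (Imp (And (P1 Phase s) (P1 Value (value_index r l)))
      (All 2 (Imp (P2 Column (column_index r i))
         (forall_in (opposites s (i %% 6) l) opposite))))))).

Definition Later : formula := Or (P1 Phase 1) (Or (P1 Phase 2) (P1 Phase 3)).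

(** Phase 0 is left out because there the actions and operations choose the next state and
    values. *)
Definition carry c i : formula :=
  All 1 (Imp (And (P1 c i) Later) (Next (P2 c i))).

(** Operation [0] changes nothing, [2r+1] increments register [r] and [2r+2]
    decrements it; values are taken modulo 3. *)
Definition delta (o r : nat) : nat :=
  if o == r.*2.+1 then 1 else if o == r.*2.+2 then 2 else 0.

Definition operations k r : formula :=
  below k.*2.+1 (fun o => below 3 (fun l =>
    All 1 (Imp (And (P1 Op o) (P1 Value (value_index r l)))
      (Next (P2 Value (value_index r ((l + delta o r) %% 3))))))).

Definition starting r : formula :=
  And (All 1 (Imp (P1 Start 0) (P1 Value (value_index r 0))))
      (below 11 (fun i => All 1 (Imp (P1 Start 0)
         (All 2 (Imp (P2 Column (column_index r i)) (Edge (if i < 4 then t2 else t1))))))).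

Definition goto o q : formula := And (P1 Op o) (Next (P2 State q)).

(** Element 4 lies in the row of [t1] iff 2v+4 <= 4, that is v = 0, and otherwise in the
    complementary row of [t2]. *)
Definition zero_test r t : formula := All 2 (Imp (P2 Column (column_index r 4)) (Edge t)).

Definition action (i : instr) : formula :=
  match i with
  | Inc r q => goto r.*2.+1 q
  | Dec r q z => Or (And (zero_test r t1) (goto 0 z))
                    (And (zero_test r t2) (goto r.*2.+2 q))
  | Jmp q => goto 0 q
  end.

Definition rule q i : formula :=
  And (carry State q) (All 1 (Imp (And (P1 State q) (P1 Phase 0)) (action i))).

Definition register k r : formula :=
  And (columns r) (And (entries r) (And (below 3 (fun l => carry Value (value_index r l)))
    (And (operations k r) (starting r)))).

(** This part is independent of the input, so that its own code can later be taken as the input. *)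
Definition base k (P : seq instr) : formula :=
  And (All 1 (Ex 2 Succ))
 (And (All 1 (Imp (P1 Start 0) (P1 Phase 0)))
 (And phases
 (And (below k (register k))
 (And (All 1 (Not (P1 State (size P).*2)))
 (And (rule 1 (Jmp 0))
      (below (size P) (fun p => rule p.*2 (machine P p.*2)))))))).

Fixpoint loading n : formula :=
  if n is m.+1 then And (rule m.*2.+3 (Inc 0 m.*2.+1)) (loading m) else Truth.

Definition input n : formula :=
  And (Ex 1 (And (P1 Start 0) (P1 State n.*2.+1))) (loading n).

(** * Membership in the two-variable fluted fragment *)

Definition fluted2 m (p : formula) := fluted m p /\ {subset vars p <= [:: 1; 2]}.

Lemma fluted2_P1 c i : fluted2 1 (P1 c i).
Proof. by split=> [|x]; [exact: (@fluted_atom 1 1 (unary c i))|rewrite /= !inE => ->]. Qed.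

Lemma fluted2_P2 c i : fluted2 2 (P2 c i).
Proof.
split=> [|x]; first exact: (@fluted_atom 2 2 (unary c i)).
by rewrite /= !inE => ->; rewrite orbT.
Qed.

Lemma fluted2_Succ : fluted2 2 Succ.
Proof. by split=> [|x] //; apply: (@fluted_atom 2 1 (Rel 2 0)). Qed.

Lemma fluted2_Edge i : fluted2 2 (Edge i).
Proof. by split=> [|x] //; apply: (@fluted_atom 2 1 (Trans i)). Qed.

Lemma fluted2_Truth m : fluted2 m Truth.
Proof.
by split=> //; apply: fluted_imp; apply: (@fluted_atom m m.+1 (Rel 0 0)); rewrite //= addn0.
Qed.

Lemma fluted2_Not m p : fluted2 m p -> fluted2 m (Not p).
Proof. by move=> [h1 h2]; split=> //; apply: fluted_not. Qed.

Lemma subset_cat (s t u : seq nat) :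
  {subset s <= u} -> {subset t <= u} -> {subset s ++ t <= u}.
Proof. by move=> h1 h2 x; rewrite mem_cat => /orP[/h1|/h2]. Qed.

Lemma fluted2_And m p q : fluted2 m p -> fluted2 m q -> fluted2 m (And p q).
Proof. by move=> [h1 h2] [h3 h4]; split; [apply: fluted_and|apply: subset_cat]. Qed.

Lemma fluted2_Or m p q : fluted2 m p -> fluted2 m q -> fluted2 m (Or p q).
Proof. by move=> [h1 h2] [h3 h4]; split; [apply: fluted_or|apply: subset_cat]. Qed.

Lemma fluted2_Imp m p q : fluted2 m p -> fluted2 m q -> fluted2 m (Imp p q).
Proof. by move=> [h1 h2] [h3 h4]; split; [apply: fluted_imp|apply: subset_cat]. Qed.

Lemma fluted2_All m p : m < 2 -> fluted2 m.+1 p -> fluted2 m (All m.+1 p).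
Proof.
move=> hm [h1 h2]; split; first exact: fluted_all.
by move=> x; rewrite inE => /orP[/eqP->|/h2] //; case: m hm {h1} => [|[]].
Qed.

Lemma fluted2_Ex m p : m < 2 -> fluted2 m.+1 p -> fluted2 m (Ex m.+1 p).
Proof.
move=> hm [h1 h2]; split; first exact: fluted_ex.
by move=> x; rewrite inE => /orP[/eqP->|/h2] //; case: m hm {h1} => [|[]].
Qed.

Lemma fluted2_forall_in m A (s : seq A) F :
  (forall x, fluted2 m (F x)) -> fluted2 m (forall_in s F).
Proof.
move=> h; elim: s => [|x s IH]; first exact: fluted2_Truth.
exact: fluted2_And.
Qed.

Create HintDb fluted.
#[local] Hint Resolve fluted2_P1 fluted2_P2 fluted2_Succ fluted2_Edge fluted2_Truth
  fluted2_Not fluted2_And fluted2_Or fluted2_Imp fluted2_All fluted2_Ex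
  fluted2_forall_in isT : fluted.

Lemma fluted2_rule q i : fluted2 0 (rule q i).
Proof.
by case: i => *; rewrite /rule /carry /Later /action /goto /zero_test /Next;
  auto 20 with fluted.
Qed.

Lemma fluted2_base k P : fluted2 0 (base k P).
Proof.
have hr := fluted2_rule.
rewrite /base /register /phases /columns /entries /operations /starting /carry
  /opposite /Later /Next /below; auto 40 with fluted.
Qed.

Lemma fluted2_input n : fluted2 0 (input n).
Proof.
have hr := fluted2_rule.
have hl : fluted2 0 (loading n) by elim: n => [|n IH] /=; auto with fluted.
by rewrite /input; auto 10 with fluted.
Qed.

Lemma FL2_encoding k P n : FL2 (And (input n) (base k P)).
Proof.
have [h1 h2] := fluted2_And (fluted2_input n) (fluted2_base k P).
split; first by exists 0.
(* A bound on the number of variables is not preserved by conjunction, but inclusion in a fixed pair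
   is; counting comes only here. *)
apply: (@uniq_leq_size _ _ [:: 1; 2]); first exact: undup_uniq.
by move=> x; rewrite mem_undup; apply: h2.
Qed.

(** * Computability of the encoding *)

Definition computable k (F : k.-tuple nat -> nat) :=
  exists f : recfun k, forall v, eval f v (F v).

Lemma eq_computable k (F G : k.-tuple nat -> nat) :
  F =1 G -> computable F -> computable G.
Proof. by move=> e [f hf]; exists f => v; rewrite -e. Qed.

Lemma computable_comp k m (G : m.-tuple nat -> nat)
    (H : 'I_m -> k.-tuple nat -> nat) :
  computable G -> (forall i, computable (H i)) ->
  computable (fun v => G [tuple H i v | i < m]).
Proof.
move=> [g hg] hH.
have /fin_all_exists[h hh] : forall i, exists f : recfun k, forall v, eval f v (H i v).
  by [].
exists (RComp g h) => v /=; exists [tuple H i v | i < m]; split=> // i.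
by rewrite tnth_mktuple.
Qed.

Lemma computable_proj k (i : 'I_k) : computable (fun v : k.-tuple nat => tnth v i).
Proof. by exists (RProj i). Qed.

Lemma computable_S k (F : k.-tuple nat -> nat) :
  computable F -> computable (fun v => (F v).+1).
Proof.
move=> hF.
have hS : computable (fun v : 1.-tuple nat => (thead v).+1) by exists RSucc.
apply: eq_computable (computable_comp hS (fun=> hF)) => v.
by rewrite /thead tnth_mktuple.
Qed.

Lemma computable_const k c : computable (fun _ : k.-tuple nat => c).
Proof.
elim: c => [|c IH]; first by exists (RZero k).
exact: computable_S.
Qed.

Lemma computable_comp1 k (G : nat -> nat) (F : k.-tuple nat -> nat) :
  computable (fun v : 1.-tuple nat => G (tnth v ord0)) ->
  computable F -> computable (fun v => G (F v)).
Proof.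
move=> hG hF; apply: eq_computable (computable_comp hG (fun=> hF)) => v.
by rewrite tnth_mktuple.
Qed.

Lemma computable_comp2 k (G : nat -> nat -> nat) (F H : k.-tuple nat -> nat) :
  computable (fun v : 2.-tuple nat => G (tnth v ord0) (tnth v (lift ord0 ord0))) ->
  computable F -> computable H -> computable (fun v => G (F v) (H v)).
Proof.
move=> hG hF hH.
have h (i : 'I_2) : computable (if i == ord0 then F else H) by case: ifP.
apply: eq_computable (computable_comp hG h) => v.
by rewrite !tnth_mktuple.
Qed.

Lemma computable_rec (R : nat -> nat -> nat) (a : nat -> nat) (g : nat -> nat -> nat -> nat) :
  computable (fun v : 1.-tuple nat => a (tnth v ord0)) ->
  computable (fun v : 3.-tuple nat =>
    g (tnth v ord0) (tnth v (lift ord0 ord0)) (tnth v (lift ord0 (lift ord0 ord0)))) ->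
  (forall p, R 0 p = a p) -> (forall n p, R n.+1 p = g n (R n p) p) ->
  computable (fun v : 2.-tuple nat => R (tnth v ord0) (tnth v (lift ord0 ord0))).
Proof.
move=> [f hf] [h hh] R0 RS; exists (RPrim f h) => v.
case/tupleP: v => x v; case/tupleP: v => p v.
exists (fun n => R n p); split=> /=.
- by have := hf [tuple of behead [tuple of x :: [tuple of p :: v]]]; rewrite R0.
- move=> i _; rewrite RS.
  by have := hh [tuple of [:: i, R i p & behead [tuple of x :: [tuple of p :: v]]]].
- by [].
Qed.

Lemma computable_rec1 (R : nat -> nat) (a : nat) (g : nat -> nat -> nat) :
  computable (fun v : 2.-tuple nat => g (tnth v ord0) (tnth v (lift ord0 ord0))) ->
  R 0 = a -> (forall n, R n.+1 = g n (R n)) ->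
  computable (fun v : 1.-tuple nat => R (tnth v ord0)).
Proof.
move=> hg R0 RS.
have h : computable (fun v : 2.-tuple nat => R (tnth v ord0)).
  apply: (@computable_rec (fun n _ => R n) (fun=> a) (fun n r _ => g n r)) => //.
    exact: computable_const.
  by apply: computable_comp2 hg _ _; apply: computable_proj.
exact: (@computable_comp2 1 (fun n _ => R n) _ _ h (@computable_proj 1 ord0) (@computable_proj 1 ord0)).
Qed.

Lemma computable_add k (F G : k.-tuple nat -> nat) :
  computable F -> computable G -> computable (fun v => F v + G v).
Proof.
move=> hF hG; apply: (@computable_comp2 k addn _ _ _ hF hG).
apply: (@computable_rec addn id (fun _ r _ => r.+1)) => //.
  exact: computable_proj.
by apply: computable_S; exact: computable_proj.
Qed.

Lemma computable_cpair k (F G : k.-tuple nat -> nat) :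
  computable F -> computable G -> computable (fun v => cpair (F v) (G v)).
Proof.
move=> hF hG; apply: computable_add => //.
apply: (@computable_comp1 _ (fun m => 'C(m.+1, 2))); last exact: computable_add.
apply: (@computable_rec1 (fun m => 'C(m.+1, 2)) 0 (fun m r => r + m.+1)) => //.
  by apply: computable_add; [|apply: computable_S]; exact: computable_proj.
by move=> m; rewrite binS bin1.
Qed.

Lemma computable_double k (F : k.-tuple nat -> nat) :
  computable F -> computable (fun v => (F v).*2).
Proof.
move=> hF; apply: eq_computable (computable_add hF hF) => v.
by rewrite addnn.
Qed.

Lemma computable_unary k c (F : k.-tuple nat -> nat) :
  computable F -> computable (fun v => code_symbol (unary c (F v))).
Proof.
move=> hF.
have h2 := computable_double hF; have h4 := computable_double h2.
have h8 := computable_double h4.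
apply: computable_cpair; first exact: computable_const.
apply: computable_cpair; first exact: computable_const.
apply: computable_add; last exact: computable_const.
by apply: eq_computable h8 => v; lia.
Qed.

Definition computable_formula k (F : k.-tuple nat -> formula) :=
  computable (fun v => code_formula (F v)).

Section Formulas.
Variable k : nat.
Implicit Types F G : k.-tuple nat -> formula.

Lemma computable_P1 c (F : k.-tuple nat -> nat) :
  computable F -> computable_formula (fun v => P1 c (F v)).
Proof.
move=> h; apply: computable_cpair; first exact: computable_const.
by apply: computable_cpair; [apply: computable_unary|apply: computable_const].
Qed.

Lemma computable_P2 c (F : k.-tuple nat -> nat) :
  computable F -> computable_formula (fun v => P2 c (F v)).
Proof.
move=> h; apply: computable_cpair; first exact: computable_const.
by apply: computable_cpair; [apply: computable_unary|apply: computable_const].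
Qed.

Lemma computable_fixed p : @computable_formula k (fun=> p).
Proof. exact: computable_const. Qed.

Lemma computable_And F G : computable_formula F -> computable_formula G ->
  computable_formula (fun v => And (F v) (G v)).
Proof.
by move=> *; apply: computable_cpair; [apply: computable_const|apply: computable_cpair].
Qed.

Lemma computable_Imp F G : computable_formula F -> computable_formula G ->
  computable_formula (fun v => Imp (F v) (G v)).
Proof.
by move=> *; apply: computable_cpair; [apply: computable_const|apply: computable_cpair].
Qed.

Lemma computable_All x F : computable_formula F ->
  computable_formula (fun v => All x (F v)).
Proof.
by move=> h; do 2?[apply: computable_cpair; first exact: computable_const].
Qed.

Lemma computable_Ex x F : computable_formula F ->
  computable_formula (fun v => Ex x (F v)).
Proof.
by move=> h; do 2?[apply: computable_cpair; first exact: computable_const].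
Qed.

Lemma computable_Next F : computable_formula F ->
  computable_formula (fun v => Next (F v)).
Proof.
by move=> h; apply: computable_All; apply: computable_Imp => //; apply: computable_fixed.
Qed.

Lemma computable_goto o (F : k.-tuple nat -> nat) : computable F ->
  computable_formula (fun v => goto o (F v)).
Proof.
move=> h; apply: computable_And; first exact: computable_fixed.
by apply: computable_Next; apply: computable_P2.
Qed.

(** The only rules that vary with the input are the loading ones, all of them increments. *)
Lemma computable_rule_Inc r (F G : k.-tuple nat -> nat) :
  computable F -> computable G ->
  computable_formula (fun v => rule (F v) (Inc r (G v))).
Proof.
move=> hF hG; apply: computable_And; apply: computable_All; apply: computable_Imp.
- by apply: computable_And; [apply: computable_P1|apply: computable_fixed].
- by apply: computable_Next; apply: computable_P2.
- by apply: computable_And; [apply: computable_P1|apply: computable_fixed].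
- exact: computable_goto.
Qed.

End Formulas.

(* Otherwise conversion evaluates the unary codes of fixed formulas. *)
#[local] Opaque cpair.

Lemma computable_input :
  @computable_formula 1 (fun v => input (tnth v ord0)).
Proof.
apply: computable_And.
  apply: computable_Ex; apply: computable_And; first exact: computable_fixed.
  apply: computable_P1; apply: computable_S; apply: computable_double.
  exact: computable_proj.
(* The recursion runs on codes: 2 is the tag of [And] in [code_formula]. *)
apply: (@computable_rec1 (code_formula \o loading) (code_formula Truth) (fun m r => cpair 2 (cpair
  (code_formula (rule m.*2.+3 (Inc 0 m.*2.+1))) r)));
  [|by rewrite /=|by move=> m; rewrite /=].
apply: computable_cpair; first exact: computable_const.
apply: computable_cpair; last exact: computable_proj.
apply: computable_rule_Inc.
  by do 3!apply: computable_S; apply: computable_double; exact: computable_proj.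
by apply: computable_S; apply: computable_double; exact: computable_proj.
Qed.

(** The diagonal step: [p] enters the conjunction only through its code, which is the argument
    itself, so the argument is used both as a number to load and as a finished subformula. *)
Lemma computable_encoding : exists f : recfun 1, forall p,
  eval f [tuple code_formula p] (code_formula (And (input (code_formula p)) p)).
Proof.
have [f hf] : computable (fun v : 1.-tuple nat =>
    cpair 2 (cpair (code_formula (input (tnth v ord0))) (tnth v ord0))).
  apply: computable_cpair; first exact: computable_const.
  apply: computable_cpair; [exact: computable_input|exact: computable_proj].
by exists f => p; apply: hf.
Qed.

(** * Semantics of the formula *)

(** [a i], [b i], [c i] are the rows of [t1], [t2], [t3] at the [i]-th of five
    consecutive time points, from one phase 0 to the next.  The threshold first
    drops from [2v+4] to some even value, unforced; the next two edges change its
    parity twice and so force it up twice, and the first of these moves is only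
    allowed at residue [2v'+2], which fixes where it dropped to. *)
Lemma threshold_step (v v' : nat) (a b c : nat -> nat -> bool) :
  v' <= v.+1 -> v <= v'.+1 ->
  (forall j, a 0 j = (2 * v + 4 <= j)) -> (forall j, b 0 j = (j < 2 * v + 4)) ->
  (forall j, a 1 j -> a 0 j) -> (forall j, b 1 j -> b 0 j) ->
  (forall j, b 2 j -> b 1 j) -> (forall j, c 2 j -> c 1 j) ->
  (forall j, a 3 j -> a 2 j) -> (forall j, b 3 j -> b 2 j) ->
  (forall j, a 4 j -> a 3 j) -> (forall j, c 4 j -> c 3 j) ->
  (forall i j, a i j -> a i j.+1) ->
  (forall i j, ~~ odd j -> b i j -> b i j.+1) ->
  (forall i j, odd j -> c i j -> c i j.+1) ->
  (forall j, c 1 j = ~~ b 1 j) ->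
  (forall j, j %% 6 = (2 * v' + 1) %% 6 -> a 1 j = ~~ b 1 j) ->
  (forall j, a 2 j = ~~ b 2 j) -> (forall j, c 2 j = ~~ b 2 j) ->
  (forall j, a 3 j = ~~ c 3 j) ->
  (forall j, j %% 6 <> (2 * v' + 2) %% 6 -> a 3 j = ~~ b 3 j) ->
  (forall j, a 4 j = ~~ b 4 j) ->
  (forall j, j %% 6 <> (2 * v' + 3) %% 6 -> a 4 j = ~~ c 4 j) ->
  (forall j, a 4 j = (2 * v' + 4 <= j)) /\ (forall j, b 4 j = (j < 2 * v' + 4)).
Proof.
move=> v1 v2 a0 b0 e0 e0' e1 e1' e2 e2' e3 e3' Ha Hb Hc o1 o1' o2 o2c o3 o3' o4 o4'.
have od m : odd (2 * v' + m) = odd m by rewrite oddD oddM.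
have mono i j j' : j <= j' -> a i j -> a i j'.
  by move=> /subnK <-; elim: (j' - j) => // m IH /IH; apply: Ha.
(* The position 2v'+1 is below the old threshold. If it entered row [a 2], complementarity would
   carry it back through [c 2], [c 1] and [a 1] to [a 0]. *)
have a2lt j : j < 2 * v' + 2 -> a 2 j = false.
  move=> hj; apply/negP => h.
  have : a 2 (2 * v' + 1) by apply: mono h; lia.
  by rewrite o2 -o2c => /e1'; rewrite o1 -o1' // => /e0; rewrite a0; lia.
have a2ge j : 2 * v + 4 <= j -> a 2 j.
  move=> hj; rewrite o2; apply/negP => /e1 /e0'; rewrite b0; lia.
have a3lt j : j < 2 * v' + 2 -> a 3 j = false.
  by move=> hj; apply/negP => /e2; rewrite a2lt.
have a2even j : ~~ odd j -> a 2 j.+1 -> a 2 j.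
  by move=> hj; rewrite !o2; apply: contraNN => /Hb; apply.
have keep3 j : j %% 6 <> (2 * v' + 2) %% 6 -> a 2 j -> a 3 j.
  by move=> hj; rewrite o3' // o2; apply: contraNN => /e2'.
have a3odd j : odd j -> a 3 j.+1 -> a 3 j.
  by move=> hj; rewrite !o3; apply: contraNN => /Hc; apply.
(* Otherwise the even threshold of [a 2] is 2v'+4 or 2v'+6. It must become odd, so [a 3] has to lose
   it, but losses are allowed only at residue 2v'+2. *)
have a2v' : a 2 (2 * v' + 2).
  apply/negPn/negP => n2.
  have n3 : ~~ a 2 (2 * v' + 3).
    apply/negP => h; case/negP: n2; apply: a2even; first by rewrite od.
    by rewrite -addnS.
  have up j : odd j -> j %% 6 <> (2 * v' + 1) %% 6 -> ~~ a 2 j -> ~~ a 2 j.+1.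
    move=> oj hj nj; apply/negP => /keep3 h.
    have /a3odd : a 3 j.+1 by apply: h; lia.
    by move=> /(_ oj) /e2; rewrite (negPf nj).
  have n4 : ~~ a 2 (2 * v' + 4).
    by rewrite addnS; apply: up => //; rewrite ?od //; lia.
  have n5 : ~~ a 2 (2 * v' + 5).
    apply/negP => h; case/negP: n4; apply: a2even; first by rewrite od.
    by rewrite -addnS.
  have n6 : ~~ a 2 (2 * v' + 6).
    by rewrite addnS; apply: up => //; rewrite ?od //; lia.
  by case/negP: n6; apply: a2ge; lia.
have a3E j : a 3 j = (2 * v' + 3 <= j).
  case: (ltngtP j (2 * v' + 2)) => hj.
  - by rewrite a3lt //; lia.
  - rewrite (_ : _ <= j); last by lia.
    apply: (@mono 3 (2 * v' + 3)); first by lia.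
    apply: keep3; first by lia.
    by apply: mono a2v'; lia.
  - rewrite hj (_ : _ <= _ = false); last by lia.
    apply/negP => h; have := @a3odd (2 * v' + 1).
    by rewrite -addnS => /(_ _ h); rewrite a3lt; [move=> /(_ ltac:(by rewrite od))|lia].
(* Parity is even again, so 2v'+3 leaves the row at its exempt residue, while complementarity with
   [c] keeps 2v'+4. *)
have a4E j : a 4 j = (2 * v' + 4 <= j).
  case: (ltngtP j (2 * v' + 3)) => hj.
  - apply/idP/idP => [/e3|]; rewrite ?a3E; lia.
  - rewrite (_ : _ <= j); last by lia.
    apply: (@mono 4 (2 * v' + 4)); first by lia.
    rewrite o4'; last by lia.
    apply/negP => /e3'; have := a3E (2 * v' + 4).
    by rewrite o3; case: (c 3 _) => //; lia.
  - rewrite hj (_ : _ <= _ = false); last by lia.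
    apply/negP => h; have : ~~ a 4 (2 * v' + 2).
      by apply/negP => /e3; rewrite a3E; lia.
    rewrite o4 negbK => /Hb; rewrite -addnS.
    by rewrite o4 in h; rewrite (negPf h) => /(_ ltac:(by rewrite od)).
split=> // j; have := a4E j; rewrite o4; case: (b 4 j) => /=; lia.
Qed.

(** Classical truth values turn the rows of an arbitrary interpretation into the boolean functions
    of [threshold_step]. *)
Definition asbool (P : Prop) : bool :=
  if excluded_middle_informative P then true else false.

Lemma asboolP P : reflect P (asbool P).
Proof. by rewrite /asbool; case: excluded_middle_informative => h; constructor. Qed.

Section Semantics.

Variables (D : Type) (I : interpretation D) (v : nat -> D).

Definition un c i (d : D) := @I (unary c i) [tuple d].
Definition su (d e : D) := @I (Rel 2 0) [tuple d; e].
Definition tr a (d e : D) := @I (Trans a) [tuple d; e].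

Notation env d e := (update (update v 1 d) 2 e).

(** These hold by conversion; as views they peel off one connective at a time and leave the large
    bounded conjunctions folded. *)
Lemma andE w p q : holds I w (And p q) -> holds I w p /\ holds I w q.
Proof. by []. Qed.

Lemma andI w p q : holds I w p -> holds I w q -> holds I w (And p q).
Proof. by []. Qed.

Lemma exE w x p : holds I w (Ex x p) -> exists d, holds I (update w x d) p.
Proof. by []. Qed.

Lemma exI w x p d : holds I (update w x d) p -> holds I w (Ex x p).
Proof. by exists d. Qed.

Lemma allE w x p : holds I w (All x p) -> forall d, holds I (update w x d) p.
Proof. by []. Qed.

Lemma allI w x p : (forall d, holds I (update w x d) p) -> holds I w (All x p).
Proof. by []. Qed.

Lemma holds_P1 c i d : holds I (update v 1 d) (P1 c i) = un c i d.
Proof. by rewrite /= /un; congr (@I _ _); apply: val_inj. Qed.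

Lemma holds_P2 c i d e : holds I (env d e) (P2 c i) = un c i e.
Proof. by rewrite /= /un; congr (@I _ _); apply: val_inj. Qed.

Lemma holds_Succ d e : holds I (env d e) Succ = su d e.
Proof. by rewrite /= /su; congr (@I _ _); apply: val_inj. Qed.

Lemma holds_Edge a d e : holds I (env d e) (Edge a) = tr a d e.
Proof. by rewrite /= /tr; congr (@I _ _); apply: val_inj. Qed.

Lemma holds_And w p q : holds I w (And p q) = (holds I w p /\ holds I w q).
Proof. by []. Qed.

Lemma holds_Or w p q : holds I w (Or p q) = (holds I w p \/ holds I w q).
Proof. by []. Qed.

Lemma holds_Imp w p q : holds I w (Imp p q) = (holds I w p -> holds I w q).
Proof. by []. Qed.

Lemma holds_Not w p : holds I w (Not p) = (~ holds I w p).
Proof. by []. Qed.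

Definition holdsE := (holds_P1, holds_P2, holds_Succ, holds_Edge, holds_And,
  holds_Or, holds_Imp, holds_Not).

Lemma holds_Truth w : holds I w Truth.
Proof. by rewrite /Truth holds_Imp. Qed.

Lemma holds_forall_in (A : eqType) w (s : seq A) F :
  holds I w (forall_in s F) <-> (forall x, x \in s -> holds I w (F x)).
Proof.
elim: s => [|x s IH] /=; first by split.
rewrite IH; split=> [[h1 h2] y|h].
  by rewrite inE => /orP[/eqP->|/h2].
by split=> [|y hy]; apply: h; rewrite inE ?eqxx ?hy ?orbT.
Qed.

Lemma holds_below w n F :
  holds I w (below n F) <-> (forall i, i < n -> holds I w (F i)).
Proof.
rewrite holds_forall_in; split=> h i; last by rewrite mem_iota; apply: h.
by move=> hi; apply: h; rewrite mem_iota.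
Qed.

Lemma holds_Next d p : holds I (update v 1 d) (Next p) <->
  (forall e, su d e -> holds I (env d e) p).
Proof.
split=> h e; have := h e; rewrite -?holds_Succ //.
Qed.

Definition later d := un Phase 1 d \/ un Phase 2 d \/ un Phase 3 d.

Definition goto_sem o q d := un Op o d /\ (forall e, su d e -> un State q e).

Lemma holds_goto o q d : holds I (update v 1 d) (goto o q) <-> goto_sem o q d.
Proof.
rewrite /goto !holdsE holds_Next; split=> -[h1 h2]; split=> // e /h2.
  by rewrite holdsE.
by rewrite holdsE.
Qed.

Definition carry_sem c i := forall d e, un c i d -> later d -> su d e -> un c i e.

Lemma holds_carry c i : holds I v (carry c i) <-> carry_sem c i.
Proof.
split=> [h d e hd hl he|h].
  have := allE h d; rewrite !holdsE => /(_ (conj hd hl)) /holds_Next /(_ e he).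
  by rewrite holdsE.
apply: allI => d.
rewrite !holdsE => -[hd hl]; apply/holds_Next => e he; rewrite holdsE.
exact: h hd hl he.
Qed.

Definition test_sem r t d := forall e, un Column (column_index r 4) e -> tr t d e.

Definition action_sem i d :=
  match i with
  | Inc r q => goto_sem r.*2.+1 q d
  | Dec r q z => (test_sem r t1 d /\ goto_sem 0 z d) \/
                 (test_sem r t2 d /\ goto_sem r.*2.+2 q d)
  | Jmp q => goto_sem 0 q d
  end.

Lemma holds_test r t d :
  holds I (update v 1 d) (zero_test r t) <-> test_sem r t d.
Proof.
split=> h; last by apply: allI => e; rewrite !holdsE; apply: h.
by move=> e; have := allE h e; rewrite !holdsE.
Qed.

Lemma holds_action i d : holds I (update v 1 d) (action i) <-> action_sem i d.
Proof.
case: i => [r q|r q z|q]; rewrite /action_sem; try exact: holds_goto.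
rewrite /action holds_Or 2!holds_And.
by rewrite !holds_goto !holds_test.
Qed.

Definition rule_sem q i := carry_sem State q /\
  forall d, un State q d -> un Phase 0 d -> action_sem i d.

Lemma holds_rule q i : holds I v (rule q i) <-> rule_sem q i.
Proof.
rewrite /rule holds_And holds_carry /rule_sem.
split=> -[h1 h2]; split=> //.
  by move=> d hq hp; apply/holds_action; have := allE h2 d; rewrite !holdsE; apply.
by apply: allI => d; rewrite !holdsE => -[hq hp]; apply/holds_action; apply: h2.
Qed.

Record register_sem k r : Prop := {
  reg_col0 : exists d, un Column (column_index r 0) d;
  reg_col : forall i d e, i < 11 -> un Column (column_index r i) d -> su d e ->
    [/\ un Column (column_index r (next_column i)) e, tr t1 d e & tr (column_edge i) d e];
  reg_entry : forall s l i d e p, s < 4 -> l < 3 -> i < 11 ->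
    un Phase s d -> un Value (value_index r l) d -> un Column (column_index r i) e ->
    p \in opposites s (i %% 6) l -> tr p.1 d e <-> ~ tr p.2 d e;
  reg_carry : forall l, l < 3 -> carry_sem Value (value_index r l);
  reg_op : forall o l d e, o < k.*2.+1 -> l < 3 ->
    un Op o d -> un Value (value_index r l) d -> su d e ->
    un Value (value_index r ((l + delta o r) %% 3)) e;
  reg_start : forall d, un Start 0 d -> un Value (value_index r 0) d;
  reg_start_col : forall d e i, un Start 0 d -> i < 11 -> un Column (column_index r i) e ->
    tr (if i < 4 then t2 else t1) d e }.

Lemma holds_opposite d e p : holds I (env d e) (opposite p) <->
  (tr p.1 d e <-> ~ tr p.2 d e).
Proof.
rewrite /opposite !holdsE; split=> [[]|[]]; by [].
Qed.

Lemma holds_register k r : holds I v (register k r) <-> register_sem k r.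
Proof.
split.
  move=> /andE[/andE[/exE[d0 h0] /holds_below hc] /andE[/holds_below he]].
  move=> /andE[/holds_below hv /andE[/holds_below ho /andE[hs /holds_below hs']]].
  split.
  - by exists d0; rewrite -holds_P1.
  - move=> i d e hi hd su_; have := allE (hc i hi) d; rewrite !holdsE => /(_ hd).
    by move=> /holds_Next /(_ e su_); rewrite !holdsE => -[? []].
  - move=> s l i d e p hs0 hl hi h1 h2 h3 hp.
    move: he => /(_ s hs0) /holds_below /(_ l hl) /holds_below.
    move=> /(_ i hi) /allE /(_ d); rewrite !holdsE => /(_ (conj h1 h2)) /allE /(_ e).
    by rewrite holds_Imp holds_P2 => /(_ h3) /holds_forall_in /(_ p hp) /holds_opposite.
  - by move=> l /hv /holds_carry.
  - move=> o l d e hok hl h1 h2 hse; have /holds_below := ho o hok.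
    move=> /(_ l hl) /allE /(_ d); rewrite !holdsE => /(_ (conj h1 h2)) /holds_Next.
    by move=> /(_ e hse); rewrite holdsE.
  - by move=> d; have := allE hs d; rewrite !holdsE.
  - move=> d e i hd hi hc0; have := allE (hs' i hi) d; rewrite !holdsE => /(_ hd) /allE /(_ e).
    by rewrite !holdsE; apply.
move=> [h0 hc he hv ho hs hs'].
apply: andI; first apply: andI.
- by case: h0 => d hd; apply: (@exI _ _ _ d); rewrite holds_P1.
- apply/holds_below => i hi; apply: allI => d; rewrite !holdsE => hd.
  by apply/holds_Next => e hse; rewrite !holdsE; have [] := hc _ _ _ hi hd hse.
apply: andI.
  apply/holds_below => s h1; apply/holds_below => l h2; apply/holds_below => i h3.
  apply: allI => d; rewrite !holdsE => -[h4 h5].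
  apply: allI => e; rewrite holds_Imp holds_P2 => h6.
  by apply/holds_forall_in => p hp; apply/holds_opposite; apply: he h6 hp.
apply: andI; first by apply/holds_below => l hl; apply/holds_carry; apply: hv.
apply: andI.
  apply/holds_below => o h1; apply/holds_below => l h2; apply: allI => d.
  rewrite !holdsE => -[h3 h4].
  by apply/holds_Next => e h5; rewrite holdsE; apply: ho h5.
apply: andI; first by apply: allI => d; rewrite !holdsE; apply: hs.
apply/holds_below => i hi; apply: allI => d; rewrite !holdsE => hd.
by apply: allI => e; rewrite !holdsE => hc0; apply: hs'.
Qed.

Record model k (P : seq instr) n : Prop := {
  mod_succ : forall d, exists e, su d e;
  mod_start : exists d, un Start 0 d /\ un State n.*2.+1 d;
  mod_start_phase : forall d, un Start 0 d -> un Phase 0 d;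
  mod_phase : forall s d e, s < 4 -> un Phase s d -> su d e ->
    un Phase (s.+1 %% 4) e /\ (forall a, a \in time_edges s -> tr a d e);
  mod_register : forall r, r < k -> register_sem k r;
  mod_halt : forall d, ~ un State (size P).*2 d;
  mod_enter : rule_sem 1 (Jmp 0);
  mod_rule : forall p, p < size P -> rule_sem p.*2 (machine P p.*2);
  mod_load : forall m, m < n -> rule_sem m.*2.+3 (Inc 0 m.*2.+1) }.

Lemma holds_loading n : holds I v (loading n) <->
  (forall m, m < n -> rule_sem m.*2.+3 (Inc 0 m.*2.+1)).
Proof.
elim: n => [|n IH]; first by split=> // _; apply: holds_Truth.
split=> [/andE[/holds_rule h1 /IH h2] m|h].
  by rewrite ltnS leq_eqVlt => /orP[/eqP->|/h2].
apply: andI; first by apply/holds_rule; apply: h.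
by apply/IH => m hm; apply: h; apply: ltnW.
Qed.

Lemma holds_encoding k P n :
  holds I v (And (input n) (base k P)) <-> model k P n.
Proof.
split.
  move=> /andE[/andE[/exE[d0 h0] /holds_loading hl] /andE[hS /andE[hs]]].
  move=> /andE[/holds_below hp /andE[/holds_below hr /andE[hh]]].
  move=> /andE[/holds_rule h1 /holds_below hP].
  split=> //.
  - by move=> d; have /exE[e] := allE hS d; rewrite holdsE => ?; exists e.
  - by exists d0; move: h0; rewrite !holdsE.
  - by move=> d; have := allE hs d; rewrite !holdsE.
  - move=> s d e s4 hd hse; have := allE (hp s s4) d.
    rewrite holds_Imp holds_P1 => /(_ hd) /holds_Next /(_ e hse) /andE[].
    rewrite holds_P2 => ? /holds_forall_in h.
    by split=> // a /h; rewrite holdsE.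
  - by move=> r /hr /holds_register.
  - by move=> d; have := allE hh d; rewrite !holdsE.
  - by move=> p /hP /holds_rule.
move=> [hS [d0 h0] hs hp hr hh h1 hP hl].
apply: andI; first apply: andI.
- by apply: (@exI _ _ _ d0); rewrite !holdsE.
- exact/holds_loading.
apply: andI.
  by apply: allI => d; have [e] := hS d; rewrite -(holds_Succ d); apply: exI.
apply: andI; first by apply: allI => d; rewrite !holdsE; apply: hs.
apply: andI.
  apply/holds_below => s s4; apply: allI => d; rewrite holds_Imp holds_P1 => hd.
  apply/holds_Next => e hse; have [h2 h3] := hp _ _ _ s4 hd hse.
  apply: andI; first by rewrite holds_P2.
  by apply/holds_forall_in => a /h3; rewrite holdsE.
apply: andI; first by apply/holds_below => r /hr /holds_register.
apply: andI; first by apply: allI => d; rewrite !holdsE; apply: hh.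
apply: andI; first exact/holds_rule.
by apply/holds_below => p /hP /holds_rule.
Qed.

End Semantics.

(** * Models follow the run *)

Definition instr_below k (i : instr) : bool :=
  match i with Inc r _ | Dec r _ _ => r < k | Jmp _ => true end.

Definition column_label (j : nat) : nat := if j <= 10 then j else 5 + (j - 5) %% 6.

Lemma column_label_lt j : column_label j < 11.
Proof. by rewrite /column_label; case: ifP; lia. Qed.

Lemma column_labelS j : column_label j.+1 = next_column (column_label j).
Proof. by rewrite /column_label /next_column; do !case: ifP; lia. Qed.

Lemma column_label_mod j : column_label j %% 6 = j %% 6.
Proof. by rewrite /column_label; case: ifP; lia. Qed.

Lemma odd_column_label j : odd (column_label j) = odd j.
Proof.
have h m : odd m = odd (m %% 6) by rewrite {1}(divn_eq m 6) oddD oddM andbF.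
by rewrite h column_label_mod -h.
Qed.

Lemma column_label_lt4 j : (column_label j < 4) = (j < 4).
Proof. by rewrite /column_label; case: ifP; lia. Qed.

Section Run.

Variables (D : Type) (I : interpretation D).
Variables (k : nat) (P : seq instr) (n : nat).
Hypothesis Itrans : forall i, transitive D (fun x y => @I (Trans i) [tuple x; y]).
Hypothesis HM : model I k P n.
Variable next : D -> D.
Hypothesis nextP : forall d, su I d (next d).
Variable column0 : nat -> D.
Hypothesis column0P : forall r, r < k -> un I Column (column_index r 0) (column0 r).

Definition column r j := iter j next (column0 r).

Definition bit a d r j := asbool (tr I a d (column r j)).

Lemma columnP r j : r < k -> un I Column (column_index r (column_label j)) (column r j).
Proof.
move=> hr; elim: j => [|j IH]; first exact: column0P.
rewrite column_labelS.
by have [] := reg_col (mod_register HM hr) (column_label_lt j) IH (nextP _).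
Qed.

Lemma bit_column a d r j : tr I a (column r j) (column r j.+1) ->
  bit a d r j -> bit a d r j.+1.
Proof.
by move=> h /asboolP h'; apply/asboolP; apply: (Itrans h' h).
Qed.

Lemma bit_time a d d' r j : tr I a d d' -> bit a d' r j -> bit a d r j.
Proof. by move=> h /asboolP h'; apply/asboolP; apply: (Itrans h h'). Qed.

Lemma bit_t1 d r j : r < k -> bit t1 d r j -> bit t1 d r j.+1.
Proof.
move=> hr; apply: bit_column.
by have [] := reg_col (mod_register HM hr) (column_label_lt j) (columnP j hr) (nextP _).
Qed.

Lemma bit_edge d r j : r < k ->
  bit (column_edge j) d r j -> bit (column_edge j) d r j.+1.
Proof.
move=> hr; apply: bit_column; rewrite /column_edge -odd_column_label.
by have [] := reg_col (mod_register HM hr) (column_label_lt j) (columnP j hr) (nextP _).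
Qed.

Lemma bit_opposite s l d r j p : s < 4 -> l < 3 -> r < k ->
  un I Phase s d -> un I Value (value_index r l) d ->
  p \in opposites s (j %% 6) l -> bit p.1 d r j = ~~ bit p.2 d r j.
Proof.
move=> hs hl hr h1 h2; rewrite -column_label_mod => hp.
have := reg_entry (mod_register HM hr) hs hl (column_label_lt j) h1 h2 (columnP j hr) hp.
by rewrite /bit; case: asboolP => ?; case: asboolP => ?; tauto.
Qed.

(** The row of [t3] is not recorded: no [t3] edge is required on leaving phase 0, and phase 1 fixes
    the row afresh as the complement of that of [t2]. *)
Definition simulates (c : config) (d : D) : Prop :=
  [/\ un I Phase 0 d, un I State c.1 d & forall r, r < k ->
    [/\ un I Value (value_index r (c.2 r %% 3)) d,
        forall j, bit t1 d r j = (2 * c.2 r + 4 <= j)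
      & forall j, bit t2 d r j = (j < 2 * c.2 r + 4)]].

(** The start clause only asserts edges, [t2] below position 4 and [t1] from there on;
    complementarity in phase 0 supplies the missing non-edges, giving the threshold 4 of value 0. *)
Lemma simulates_start : exists d, simulates (n.*2.+1, fun=> 0) d.
Proof.
have [d [hs hq]] := mod_start HM; exists d.
have hp := mod_start_phase HM hs; split=> // r hr.
have hv := reg_start (mod_register HM hr) hs.
have h j : bit (if j < 4 then t2 else t1) d r j.
  rewrite -column_label_lt4; apply/asboolP.
  exact: (reg_start_col (mod_register HM hr) hs (column_label_lt j) (columnP j hr)).
have o j : bit t1 d r j = ~~ bit t2 d r j.
  apply: (@bit_opposite 0 0 d r j (t1, t2)) => //.
  by rewrite /opposites inE eqxx.
split=> // j; have := h j; have := o j; case: ltnP => hj.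
- by move=> -> ->; lia.
- by move=> _ ->; lia.
- by move=> _ ->; lia.
- by move=> -> /negPf ->; lia.
Qed.

(** A model may choose either disjunct of a [Dec] action, but the exact rows refute the wrong zero
    test at column element 4. *)
Lemma action_step c d : simulates c d -> instr_below k (machine P c.1) ->
  action_sem I (machine P c.1) d ->
  exists o, [/\ o < k.*2.+1, un I Op o d,
    forall e, su I d e -> un I State (step (machine P) c).1 e
  & forall r, let s := c.2 r in let s' := (step (machine P) c).2 r in
    [/\ (s + delta o r) %% 3 = s' %% 3, s' <= s.+1 & s <= s'.+1]].
Proof.
case: c => q s [_ _ hv] /=; rewrite /step /=; rewrite /= in hv.
case: (machine P q) => [r q'|r q' z|q'] /= hr.
- move=> [ho hq]; exists r.*2.+1; split=> // [|r']; first by lia.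
  rewrite /upd /delta; case: (eqVneq r' r) => [->|hn] /=.
    by rewrite eqxx; split; lia.
  do 2?[case: eqP => ?]; try lia; by rewrite addn0; split=> //; lia.
- have [_ b1 b2] := hv r hr.
  have test t : test_sem I r t d -> bit t d r 4.
    by move=> ht; apply/asboolP; apply: ht; apply: (columnP 4 hr).
  have stay r' : [/\ (s r' + delta 0 r') %% 3 = s r' %% 3, s r' <= (s r').+1
                  & s r' <= (s r').+1] by rewrite /delta /= addn0; split.
  case es: (s r) => [|x] [[/test]|[/test]] /=.
  + by move=> _ [ho hq]; exists 0; split.
  + by rewrite b2 es.
  + by rewrite b1 es; lia.
  + move=> _ [ho hq]; exists r.*2.+2; split=> // [|r']; first by lia.
    rewrite /upd /delta; case: (eqVneq r' r) => [->|hn] /=.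
      by rewrite es; do 2?[case: eqP => ?]; try lia; split; lia.
    do 2?[case: eqP => ?]; try lia; by rewrite addn0; split=> //; lia.
- move=> [ho hq]; exists 0; split=> // r'.
  by rewrite /delta /= addn0; split.
Qed.

Lemma simulates_step c d : simulates c d -> instr_below k (machine P c.1) ->
  rule_sem I c.1 (machine P c.1) -> carry_sem I State (step (machine P) c).1 ->
  exists d', simulates (step (machine P) c) d'.
Proof.
move=> hsim hk [_ hact] hcarry; have [hp hq hv] := hsim.
have [o [ok ho hq' hd]] := action_step hsim hk (hact _ hq hp).
set c' := step _ c in hd hq' hcarry *.
pose D_ i := iter i next d.
have sD i : su I (D_ i) (D_ i.+1) by apply: nextP.
have ph i : i < 5 -> un I Phase (i %% 4) (D_ i).
  elim: i => [|i IH] hi; first exact: hp.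
  have [h _] := mod_phase HM (ltn_pmod i (isT : 0 < 4)) (IH (ltnW hi)) (sD i).
  by move: h; rewrite -addn1 modnDml addn1.
have edge i a : i < 4 -> a \in time_edges i -> tr I a (D_ i) (D_ i.+1).
  move=> hi; have hi' : i %% 4 = i by rewrite modn_small.
  have := ph i (ltnW hi); rewrite hi' => h.
  have [_ h'] := mod_phase HM hi h (sD i); exact: h'.
have later_ i : 0 < i < 4 -> later I (D_ i).
  move=> hi; have := ph i; rewrite modn_small; last by lia.
  by move: i hi => [|[|[|[|i]]]] // _ /(_ isT); rewrite /later; tauto.
have st i : i < 4 -> un I State c'.1 (D_ i.+1).
  elim: i => [|i IH] hi; first by apply: hq'; exact: (sD 0).
  by apply: hcarry (IH (ltnW hi)) (later_ _ _) (sD _); lia.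
have va r i : r < k -> i < 4 -> un I Value (value_index r (c'.2 r %% 3)) (D_ i.+1).
  move=> hr; have [hl _ _] := hv r hr.
  elim: i => [|i IH] hi.
    have [<- _ _] := hd r; rewrite -modnDml.
    by apply: (reg_op (mod_register HM hr) ok _ ho hl (sD 0)); rewrite ltn_pmod.
  by apply: (reg_carry (mod_register HM hr) _ (IH (ltnW hi)) (later_ _ _) (sD _));
    rewrite ?ltn_pmod //; lia.
exists (D_ 4); split; [exact: (ph 4)|exact: (st 3)|move=> r hr].
have [hl h1 h2] := hv r hr.
have [_ s1 s2] := hd r.
(* The value label changes on leaving phase 0, so the conditions at all four later points, including
   the next phase 0, refer to the new value. *)
have opp i j p : i < 4 -> p \in opposites (i.+1 %% 4) (j %% 6) (c'.2 r %% 3) ->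
    bit p.1 (D_ i.+1) r j = ~~ bit p.2 (D_ i.+1) r j.
  by move=> hi; apply: bit_opposite; rewrite ?ltn_pmod //; [exact: (ph i.+1)|exact: va].
have tim i j a : i < 4 -> a \in time_edges i ->
    bit a (D_ i.+1) r j -> bit a (D_ i) r j.
  by move=> hi ha; apply: bit_time; exact: edge.
have res m j : (j %% 6 == (2 * (c'.2 r %% 3) + m) %% 6) =
    (j %% 6 == (2 * c'.2 r + m) %% 6).
  by congr (_ == _); lia.
have [a4 b4] : (forall j, bit t1 (D_ 4) r j = (2 * c'.2 r + 4 <= j)) /\
    (forall j, bit t2 (D_ 4) r j = (j < 2 * c'.2 r + 4)).
  apply: (@threshold_step (c.2 r) (c'.2 r) (fun i => bit t1 (D_ i) r)
    (fun i => bit t2 (D_ i) r) (fun i => bit t3 (D_ i) r)) => //.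
  - by move=> j; apply: tim; rewrite ?inE ?eqxx ?orbT.
  - by move=> j; apply: tim; rewrite ?inE ?eqxx ?orbT.
  - by move=> j; apply: tim; rewrite ?inE ?eqxx ?orbT.
  - by move=> j; apply: tim; rewrite ?inE ?eqxx ?orbT.
  - by move=> j; apply: tim; rewrite ?inE ?eqxx ?orbT.
  - by move=> j; apply: tim; rewrite ?inE ?eqxx ?orbT.
  - by move=> j; apply: tim; rewrite ?inE ?eqxx ?orbT.
  - by move=> j; apply: tim; rewrite ?inE ?eqxx ?orbT.
  - by move=> i j; apply: bit_t1.
  - by move=> i j ej; have := @bit_edge (D_ i) r j hr; rewrite /column_edge (negPf ej).
  - by move=> i j ej; have := @bit_edge (D_ i) r j hr; rewrite /column_edge ej.
  - by move=> j; apply: (@opp 0 j (t3, t2)); rewrite // inE eqxx.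
  - move=> j /eqP ej; apply: (@opp 0 j (t1, t2)) => //.
    by rewrite /opposites /= res ej !inE eqxx orbT.
  - by move=> j; apply: (@opp 1 j (t1, t2)); rewrite // inE eqxx.
  - by move=> j; apply: (@opp 1 j (t3, t2)); rewrite // !inE eqxx orbT.
  - by move=> j; apply: (@opp 2 j (t1, t3)); rewrite // inE eqxx.
  - move=> j /eqP /negPf ej; apply: (@opp 2 j (t1, t2)) => //.
    by rewrite /opposites /= res ej !inE eqxx orbT.
  - by move=> j; apply: (@opp 3 j (t1, t2)); rewrite // inE eqxx.
  - move=> j /eqP /negPf ej; apply: (@opp 3 j (t1, t3)) => //.
    by rewrite /opposites /= res ej !inE eqxx orbT.
by split; first exact: (va r 3).
Qed.

End Run.

Lemma machine_odd P m : machine P m.*2.+3 = Inc 0 m.*2.+1.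
Proof. by rewrite /machine /= odd_double subn2. Qed.

Lemma machine_below k P q : 0 < k -> all (instr_below k) P -> instr_below k (machine P q).
Proof.
move=> hk hP; rewrite /machine; case: ifP => _; first by case: ifP.
case: (ltnP q./2 (size P)) => hq; last by rewrite nth_default.
by have := all_nthP (Jmp q./2) hP _ hq; case: (nth _ P _).
Qed.

(** Instructions of [P] have even targets only, so odd states occur while loading and decrease; the
    finitely many rules of [loading n] thus cover them. *)
Lemma run_odd P n t : odd (run P n t).1 -> (run P n t).1 <= n.*2.+1.
Proof.
elim: t => [//|t IH]; rewrite /run iterS -/(run P n t) /step.
case: (run P n t) IH => q s /= IH; rewrite /machine.
case: (boolP (odd q)) => oq.
  by case: ifP => // _ /= _; have := IH oq; lia.
by case: (nth _ P _) => [r p|r p z|p] /=; try case: (s r) => [|x]; rewrite /= odd_double.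
Qed.

Lemma step_absorb P c : ~~ odd c.1 -> (size P).*2 <= c.1 -> step (machine P) c = c.
Proof.
case: c => q s /= oq hq; rewrite /step /machine /= (negPf oq) nth_default /=; last by lia.
by rewrite even_halfK.
Qed.

Lemma model_not_halts (D : Type) (I : interpretation D) k P n :
  (forall i, transitive D (fun x y => @I (Trans i) [tuple x; y])) ->
  model I k P n -> 0 < k -> all (instr_below k) P -> ~ halts P n.
Proof.
move=> Itrans HM hk hP [t0 ht0].
have [next nextP] := functional_choice (fun d e => su I d e) (mod_succ HM).
have [|column0 column0P] := functional_choice
    (fun r d => r < k -> un I Column (column_index r 0) d).
  move=> r; case: (boolP (r < k)) => hr; last by have [d _] := mod_start HM; exists d.
  by have [d] := reg_col0 (mod_register HM hr); exists d.
have ex : exists t, (run P n t).1 == (size P).*2 by exists t0; apply/eqP.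
case: (ex_minnP ex) => [[|t] /eqP ht tmin].
  by move: (congr1 odd ht); rewrite /= !odd_double.
have ruled j : j <= t -> rule_sem I (run P n j).1 (machine P (run P n j).1).
  move=> jt; have := @run_odd P n j.
  (* Outside [P] the machine loops in place, so being there at time j <= t would mean being in the
     halting state already, against the minimality of [t.+1]. *)
  have absorbed : ~~ odd (run P n j).1 -> (size P).*2 <= (run P n j).1 -> False.
    move=> h1 h2; have h3 : run P n t.+1 = run P n j.
      have {1}-> : t.+1 = t.+1 - j + j by lia.
      rewrite /run iterD -/(run P n j); elim: (t.+1 - j) => [//|m IH].
      by rewrite iterS IH step_absorb.
    have := tmin j; rewrite -h3 ht eqxx => /(_ isT); lia.
  case: (boolP (odd _)) => oq; last first.
    rewrite -(even_halfK oq) => _; apply: (mod_rule HM).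
    rewrite -ltn_double even_halfK // ltnNge; apply/negP; exact: absorbed.
  move=> /(_ isT) hq; case e: (run P n j).1 oq hq => [//|[|q]] oq hq.
    exact: (mod_enter HM).
  have -> : q.+2 = (q./2).*2.+3 by move: oq => /=; lia.
  by rewrite machine_odd; apply: (mod_load HM); lia.
have sim j : j <= t -> exists d, simulates I k next column0 (run P n j) d.
  elim: j => [_|j IH hj].
    exact: (simulates_start HM nextP column0P).
  have [d hd] := IH (ltnW hj).
  have [d' hd'] := simulates_step Itrans HM nextP column0P hd
    (machine_below _ hk hP) (ruled j (ltnW hj)) (ruled j.+1 hj).1.
  by exists d'.
have [d hd] := sim t (leqnn t).
have [hp hq _] := hd.
(* The halting state has no [carry], so the last step is not simulated in full; one successor
   bearing its label is already a contradiction. *)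
have [o [_ _ h _]] := action_step HM nextP column0P hd (machine_below _ hk hP)
  ((ruled t (leqnn t)).2 _ hq hp).
have := h _ (nextP d); have -> : step (machine P) (run P n t) = run P n t.+1 by [].
rewrite ht.
exact: (mod_halt HM).
Qed.

(** * A model from a diverging run *)

Section Standard.

Variables (P : seq instr) (n : nat).

(** A time point, or a register with a position in its column. *)
Definition point := (nat + nat * nat)%type.

(** Four time points per machine step; the configuration changes on leaving
    phase 0. *)
Definition config_at (t : nat) : config := run P n ((t + 3) %/ 4).

Definition reg (t r : nat) : nat := (config_at t).2 r.

(** The transitive closure of the unit edges from [e] to [e.+1] with [E e]. *)
Definition reach (E : nat -> bool) (a b : nat) : Prop :=
  a < b /\ forall e, a <= e < b -> E e.

Lemma reach_trans E a b c : reach E a b -> reach E b c -> reach E a c.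
Proof.
move=> [h1 h2] [h3 h4]; split=> [|e he]; first exact: ltn_trans h1 h3.
by case: (ltnP e b) => eb; [apply: h2|apply: h4]; lia.
Qed.

Lemma reach1 (E : nat -> bool) a : E a -> reach E a a.+1.
Proof. by move=> h; split=> // e he; have -> : e = a by lia. Qed.

Lemma reach_ind E (Q : nat -> Prop) a b : reach E a b ->
  (forall e, E e -> Q e -> Q e.+1) -> Q a -> Q b.
Proof.
move=> [h1 h2] h; move: (ltnW h1) h2 => /subnKC <-.
elim: (b - a) => [|m IH] h2 qa; first by rewrite addn0.
rewrite addnS; apply: h; first by apply: h2; lia.
by apply: IH => // e he; apply: h2; lia.
Qed.

Definition time_edge (a : 'I_3) (t : nat) : bool := a \in time_edges (t %% 4).

Definition col_edge (a : 'I_3) (j : nat) : bool := (a == t1) || (a == column_edge j).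

(** With x the new value, the threshold goes 2x+2, 2x+2, 2x+3, 2x+4 through phases 1, 2, 3, 0. A
    relation may lag behind: [t1] keeps the old threshold in phase 1 (hence [t.-1]), [t2] lags in
    phase 3 and [t3] in phase 0. [t3] is the upper part in phases 1 and 2 and the lower part in 3
    and 0; it changes sides on the two edges where [time_edges] omits it. *)
Definition entry (a : 'I_3) (t r j : nat) : bool :=
  let v := 2 * reg t r in
  match nat_of_ord a, t %% 4 with
  | 0, 0 => v + 4 <= j
  | 0, 1 => 2 * reg t.-1 r + 4 <= j
  | 0, 2 => v + 2 <= j
  | 0, _ => v + 3 <= j
  | 1, 0 => j < v + 4
  | 1, _ => j < v + 2
  | _, 0 | _, 3 => j < v + 3
  | _, _ => v + 2 <= j
  end.

Definition related (a : 'I_3) (x y : point) : Prop :=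
  match x, y with
  | inl t, inl t' => reach (time_edge a) t t'
  | inl t, inr (r, j) => entry a t r j
  | inr (r, j), inr (r', j') => r = r' /\ reach (col_edge a) j j'
  | inr _, inl _ => False
  end.

Definition successor (x y : point) : Prop :=
  match x, y with
  | inl t, inl t' => t' = t.+1
  | inr (r, j), inr (r', j') => r' = r /\ j' = j.+1
  | _, _ => False
  end.

Definition operation (c : config) : nat :=
  match machine P c.1 with
  | Inc r _ => r.*2.+1
  | Dec r _ _ => if c.2 r is 0 then 0 else r.*2.+2
  | Jmp _ => 0
  end.

Definition labelled (c i : nat) (x : point) : Prop :=
  match c, x with
  | 0, inl t => i = (config_at t).1
  | 1, inr (r, j) => i = column_index r (column_label j)
  | 2, inl t => exists r, i = value_index r (reg t r %% 3)
  | 3, inl t => t %% 4 = 0 /\ i = operation (config_at t)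
  | 4, inl t => i = t %% 4
  | 5, inl t => t = 0 /\ i = 0
  | _, _ => False
  end.

(** Arguments are taken as a sequence because the type of the tuple depends on the arity of the
    symbol being matched. *)
Definition standard_atom (s : symbol) (l : seq point) : Prop :=
  match s, l with
  | Trans i, [:: x; y] => related i x y
  | Rel 1 m, [:: x] => labelled (m %% 8) (m %/ 8) x
  | Rel 2 _, [:: x; y] => successor x y
  | _, _ => True
  end.

Definition standard : interpretation point := fun s a => standard_atom s a.

Lemma standard_un c i x : un standard c i x = labelled (class_index c) i x.
Proof.
rewrite /un /= modnMDl divnMDl // divn_small; last by case: c.
by rewrite addn0 modn_small //; case: c.
Qed.

Lemma val_t1 : t1 = 0 :> nat. Proof. exact: inordK. Qed.
Lemma val_t2 : t2 = 1 :> nat. Proof. exact: inordK. Qed.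
Lemma val_t3 : t3 = 2 :> nat. Proof. exact: inordK. Qed.

Lemma case_t (Q : 'I_3 -> Prop) : Q t1 -> Q t2 -> Q t3 -> forall a, Q a.
Proof.
move=> h1 h2 h3 [[|[|[|m]]] hm] //.
- by have <- : t1 = Ordinal hm by apply: val_inj; rewrite /= val_t1.
- by have <- : t2 = Ordinal hm by apply: val_inj; rewrite /= val_t2.
- by have <- : t3 = Ordinal hm by apply: val_inj; rewrite /= val_t3.
Qed.

Lemma t_neq : (t1 == t2 = false) * (t1 == t3 = false) * (t2 == t1 = false) *
  (t2 == t3 = false) * (t3 == t1 = false) * (t3 == t2 = false).
Proof. by rewrite -!val_eqE /= val_t1 val_t2 val_t3. Qed.

Lemma entryE1 t r j : entry t1 t r j = match t %% 4 with
  | 0 => 2 * reg t r + 4 <= j | 1 => 2 * reg t.-1 r + 4 <= j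
  | 2 => 2 * reg t r + 2 <= j | _ => 2 * reg t r + 3 <= j end.
Proof. by rewrite /entry val_t1. Qed.

Lemma entryE2 t r j : entry t2 t r j = match t %% 4 with
  | 0 => j < 2 * reg t r + 4 | _ => j < 2 * reg t r + 2 end.
Proof. by rewrite /entry val_t2. Qed.

Lemma entryE3 t r j : entry t3 t r j = match t %% 4 with
  | 0 | 3 => j < 2 * reg t r + 3 | _ => 2 * reg t r + 2 <= j end.
Proof. by rewrite /entry val_t3. Qed.

Definition entryE := (entryE1, entryE2, entryE3).

Lemma config_atS t : config_at t.+1 =
  if t %% 4 == 0 then step (machine P) (config_at t) else config_at t.
Proof.
rewrite /config_at /run; case: eqP => ht; last by congr iter; lia.
by rewrite -iterS; congr iter; lia.
Qed.

Lemma regS t r : t %% 4 <> 0 -> reg t.+1 r = reg t r.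
Proof. by move=> /eqP /negPf h; rewrite /reg config_atS h. Qed.

Lemma reg_step t r : t %% 4 = 0 ->
  [/\ (reg t r + delta (operation (config_at t)) r) %% 3 = reg t.+1 r %% 3,
      reg t.+1 r <= (reg t r).+1 & reg t r <= (reg t.+1 r).+1].
Proof.
move=> h; rewrite /reg config_atS h eqxx.
case: (config_at t) => q s /=; rewrite /step /operation /=.
case: (machine P q) => [r' p|r' p z|p] /=.
- rewrite /upd /delta; case: (eqVneq r r') => [->|hn] /=.
    by rewrite eqxx; split; lia.
  do 2?[case: eqP => ?]; try lia; by rewrite addn0; split=> //; lia.
- case es: (s r') => [|x] /=; first by rewrite /delta /= addn0; split.
  rewrite /upd /delta; case: (eqVneq r r') => [->|hn] /=.
    by rewrite es; do 2?[case: eqP => ?]; try lia; split; lia.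
  do 2?[case: eqP => ?]; try lia; by rewrite addn0; split=> //; lia.
- by rewrite /delta /= addn0; split.
Qed.

Lemma mod4_cases t : [\/ t %% 4 = 0 /\ t.+1 %% 4 = 1, t %% 4 = 1 /\ t.+1 %% 4 = 2,
  t %% 4 = 2 /\ t.+1 %% 4 = 3 | t %% 4 = 3 /\ t.+1 %% 4 = 0].
Proof.
have : t %% 4 < 4 by rewrite ltn_pmod.
case e: (t %% 4) => [|[|[|[|m]]]] // _;
  [apply: Or41|apply: Or42|apply: Or43|apply: Or44]; split=> //; lia.
Qed.

Lemma entry_time a t r j : time_edge a t -> entry a t.+1 r j -> entry a t r j.
Proof.
rewrite /time_edge; case: (mod4_cases t) => -[e e']; rewrite e.
- have [_ h1 h2] := @reg_step t r e.
  by elim/case_t: a; rewrite !inE ?eqxx ?t_neq //= !entryE e e' /=; lia.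
- have h := @regS t r; rewrite e in h.
  by elim/case_t: a; rewrite !inE ?eqxx ?t_neq //= !entryE e e' h.
- have h := @regS t r; rewrite e in h.
  by elim/case_t: a; rewrite !inE ?eqxx ?t_neq //= !entryE e e' h //; lia.
- have h := @regS t r; rewrite e in h.
  by elim/case_t: a; rewrite !inE ?eqxx ?t_neq //= !entryE e e' h //; lia.
Qed.

Lemma odd_double_add m x : odd (2 * m + x) = odd x.
Proof. by rewrite oddD oddM. Qed.

Lemma entry_col a t r j : col_edge a j -> entry a t r j -> entry a t r j.+1.
Proof.
(* For a lower part the column edge starts at a [j] of the parity of the threshold, so [j.+1] cannot
   be the threshold. *)
have lt m x : odd j = odd x -> j < 2 * m + x -> j.+1 < 2 * m + x.
  move=> ho; rewrite leq_eqVlt => /orP[/eqP e|//].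
  by move: ho; rewrite -(odd_double_add m x) -e /=; case: (odd j).
rewrite /col_edge /column_edge; case: (mod4_cases t) => -[e _];
  elim/case_t: a; rewrite ?eqxx ?t_neq !entryE e /=; case: (boolP (odd j)) => oj;
  rewrite ?eqxx ?t_neq //= => _; try lia; by apply: lt; rewrite ?oj ?(negPf oj).
Qed.

(** No edge leads from a column back to time, so the mixed cases are two: entries are inherited
    backwards along time edges and forwards along column edges. *)
Lemma related_trans a : transitive point (related a).
Proof.
move=> [t|[r j]] [t'|[r' j']] [t''|[r'' j'']] //=.
- exact: reach_trans.
- move=> h e'; move: (h) => [lt _]; move: e'.
  have : ~~ entry a t r'' j'' -> ~~ entry a t' r'' j''.
    apply: (@reach_ind (time_edge a) (fun u => ~~ entry a u r'' j'')) h _ => u hu.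
    by apply: contraNN; apply: entry_time.
  by move=> h' he; apply/negPn/negP => /h'; rewrite he.
- move=> he [<- h].
  by apply: (@reach_ind (col_edge a) (fun u => entry a t r' u)) h _ he => u hu; apply: entry_col.
- by move=> [-> h1] [<- h2]; split=> //; apply: reach_trans h1 h2.
Qed.

Lemma standard_trans i : transitive point (fun x y => @standard (Trans i) [tuple x; y]).
Proof. exact: related_trans. Qed.

Lemma value_index_inj r l r' l' : l < 3 -> l' < 3 ->
  value_index r l = value_index r' l' -> r = r' /\ l = l'.
Proof. by rewrite /value_index; lia. Qed.

Lemma column_index_inj r l r' l' : l < 11 -> l' < 11 ->
  column_index r l = column_index r' l' -> r = r' /\ l = l'.
Proof. by rewrite /column_index; lia. Qed.

Lemma reg_mod t r : reg t r %% 3 < 3.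
Proof. exact: ltn_pmod. Qed.

(** Required pairs could fail only where a row lags: at 2x+3 in phase 0 and 2x+2 in phase 3, both
    exempt, and in phase 1 from 2x+2 up to the old threshold. That is at most 2x+6, so residue 2x+1
    is avoided. *)
Lemma opposites_entry t r j p :
  p \in opposites (t %% 4) (j %% 6) (reg t r %% 3) ->
  entry p.1 t r j = ~~ entry p.2 t r j.
Proof.
case: (mod4_cases t) => -[e _]; rewrite e /=.
- case: ifP => hj; rewrite !inE; [move=> /eqP->|move=> /orP[]/eqP->];
    rewrite /= !entryE e; lia.
- have e1 : t.-1 %% 4 = 0 by lia.
  have [_ h1 h2] := @reg_step t.-1 r e1.
  rewrite prednK in h1 h2; last by lia.
  case: ifP => hj; rewrite !inE; [move=> /orP[]/eqP->|move=> /eqP->];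
    rewrite /= !entryE e; lia.
- by rewrite !inE => /orP[]/eqP-> /=; rewrite !entryE e; lia.
- case: ifP => hj; rewrite !inE; [move=> /eqP->|move=> /orP[]/eqP->];
    rewrite /= !entryE e; lia.
Qed.

Lemma standard_later t : later standard (inl t) -> t %% 4 <> 0.
Proof. by rewrite /later !standard_un /=; lia. Qed.

Lemma standard_register k r : register_sem standard k r.
Proof.
split.
- by exists (inr (r, 0)); rewrite standard_un.
- move=> i [t|[r' j]] [t'|[r'' j']] hi; rewrite !standard_un //= => ei [-> ->].
  have [<- ->] := column_index_inj hi (column_label_lt j) ei.
  rewrite -column_labelS; split=> //; split=> //; apply: reach1; rewrite /col_edge ?eqxx //.
  by rewrite /column_edge odd_column_label eqxx orbT.
- move=> s l i [t|[r' j]] [t'|[r'' j']] p s4 hl hi; rewrite !standard_un //= => ->.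
  move=> [r0 /(value_index_inj hl (reg_mod _ _)) [<- ->]].
  move=> /(column_index_inj hi (column_label_lt _)) [<- ->].
  rewrite column_label_mod => /opposites_entry h.
  by rewrite /tr /= h; split=> /negP.
- move=> l hl [t|[r' j]] [t'|[r'' j']]; rewrite !standard_un //=.
  move=> [r0 /(value_index_inj hl (reg_mod _ _)) [<- ->]] /standard_later ht ->.
  by exists r; rewrite regS.
- move=> o l [t|[r' j]] [t'|[r'' j']] ho hl; rewrite !standard_un //=.
  move=> [ht ->] [r0 /(value_index_inj hl (reg_mod _ _)) [<- ->]] ->.
  by exists r; rewrite modnDml; have [-> _ _] := @reg_step t r ht.
- move=> [t|[r' j]]; rewrite !standard_un //= => -[-> _].
  by exists r.
- move=> [t|[r' j]] [t'|[r'' j']] i; rewrite !standard_un //= => -[-> _] hi.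
  move=> /(column_index_inj hi (column_label_lt _)) [<- ->].
  rewrite column_label_lt4 /tr /=; case: ltnP => hj; rewrite entryE //=.
Qed.

Lemma standard_rule q : rule_sem standard q (machine P q).
Proof.
have go t o q' : t %% 4 = 0 -> o = operation (config_at t) ->
    q' = (step (machine P) (config_at t)).1 -> goto_sem standard o q' (inl t).
  move=> ht -> ->; split; first by rewrite standard_un.
  by move=> [t'|[r j]]; rewrite standard_un //= => ->; rewrite config_atS ht.
split.
  move=> [t|[r j]] [t'|[r' j']]; rewrite !standard_un //=.
  by move=> -> /standard_later /eqP /negPf h ->; rewrite config_atS h.
move=> [t|[r j]]; rewrite !standard_un //=.
move=> -> /esym ht; have hgo := go t _ _ ht.
case ei: (machine P (config_at t).1) => [r q'|r q' z|q'] /=.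
- by apply: hgo; rewrite /operation /step ei.
- have test a : entry a t r 4 -> test_sem standard r a (inl t).
    move=> h [t'|[r' j]]; rewrite standard_un //=.
    move=> /(column_index_inj (isT : 4 < 11) (column_label_lt _)) [<- ej].
    have -> // : j = 4 by move: ej; rewrite /column_label; case: ifP; lia.
  case es: ((config_at t).2 r) => [|x].
    left; split; first by apply: test; rewrite entryE ht /reg es.
    by apply: hgo; rewrite /operation /step ei es.
  right; split; first by apply: test; rewrite entryE ht /reg es; lia.
  by apply: hgo; rewrite /operation /step ei es.
- by apply: hgo; rewrite /operation /step ei.
Qed.

Lemma standard_model k : ~ halts P n -> model standard k P n.
Proof.
move=> nh; split.
- by move=> [t|[r j]]; [exists (inl t.+1)|exists (inr (r, j.+1))].
- by exists (inl 0); rewrite !standard_un.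
- by move=> [t|[r j]]; rewrite !standard_un //= => -[-> _].
- move=> s [t|[r j]] [t'|[r' j']] s4; rewrite !standard_un //= => -> ->.
  split; first by lia.
  by move=> a ha; apply: reach1.
- by move=> r _; apply: standard_register.
- move=> [t|[r j]]; rewrite standard_un //= => h; apply: nh.
  by exists ((t + 3) %/ 4); rewrite h.
- exact: (standard_rule 1).
- by move=> p _; apply: standard_rule.
- by move=> m _; rewrite -(machine_odd P m); apply: standard_rule.
Qed.

End Standard.

(** * Undecidability *)

Lemma registers_bounded P : exists2 k, 0 < k & all (instr_below k) P.
Proof.
elim: P => [|i P [k k0 hk]]; first by exists 1.
pose r := match i with Inc r _ | Dec r _ _ => r | Jmp _ => 0 end.
exists (maxn r.+1 k); first by rewrite leq_max k0 orbT.
rewrite /= (sub_all _ hk) ?andbT => [|j].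
  by rewrite /r; case: i {r} => [r q|r q z|q] //=; rewrite leq_max ltnSn.
by case: j => [s q|s q z|q] //= h; rewrite leq_max h orbT.
Qed.

Lemma satisfiable_encoding k P n : 0 < k -> all (instr_below k) P ->
  satisfiable_3T (And (input n) (base k P)) <-> ~ halts P n.
Proof.
move=> k0 hk; split=> [[D [I [v [hI /holds_encoding hM]]]]|nh].
  exact: model_not_halts hI hM k0 hk.
exists point, (standard P n), (fun=> inl 0); split; first exact: standard_trans.
by apply/holds_encoding; apply: standard_model.
Qed.

Theorem theorem13 : ~ decidable_problem code_formula FL2 satisfiable_3T.
Proof.
move=> [f hf].
have [e he] := computable_encoding.
have [P hP] := recfun_machine (RComp f (fun _ : 'I_1 => e)).
have [k k0 hk] := registers_bounded P.
pose n := code_formula (base k P); pose p := And (input n) (base k P).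
have answer y : eval f [tuple code_formula p] y ->
    eval (RComp f (fun _ : 'I_1 => e)) [tuple n] y.
  move=> hy; exists [tuple code_formula p]; split=> // i.
  by rewrite (ord1 i); apply: he.
have [yes no] := hf p (FL2_encoding k P n).
have sat := satisfiable_encoding n k0 hk.
have [halt1 halt0] := hP n.
case: (classic (satisfiable_3T p)) => h.
  by apply: (sat.1 h); apply: halt1; apply: answer; apply: yes.
case: (h); apply/sat; apply: halt0; apply: answer; exact: no h.
Qed.
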